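(* Assume that $F$ is $\mu$-strongly convex with $\mu>0$, that $f(\cdot;\xi)$ is $L$-smooth for every realization of $\xi$ (the functions $f(\cdot;\xi)$ need not be convex), and that the shared memory is consistent with (constant) delay $\tau$. Let $\kappa=\frac{L}{\mu}$. Consider the Hogwild! general recursion $$w_{t+1}=w_t-\eta_td_{\xi_t}S^{\xi_t}_{u_t}\nabla f(\hat w_t;\xi_t),\qquad t\ge0,$$ for sets $S^\xi_u$ with parameter $D$. Let $\eta_t=\frac{\alpha_t}{\mu(t+E)}$ with $4\le\alpha_t\le\alpha$, where $E$ is a constant with $E\ge2\tau$ and $E\ge\frac{4L\kappa\alpha D}{\mu}$. Then the expected number of single vector entry updates after $t$ iterations is equal to $$t'=t\,\bar\Delta_D/D,\qquad\text{where }\bar\Delta_D=D\cdot\mathbb{E}[\lceil|D_\xi|/D\rceil],$$ and $$\mathbb{E}[\|\hat w_t-w_*\|^2]\le\frac{4\alpha^2DN}{\mu^2}\frac{t}{(t+E-1)^2}+O\Big(\frac{\ln t}{(t+E-1)^2}\Big),$$ $$\mathbb{E}[\|w_t-w_*\|^2]\le\frac{4\alpha^2DN}{\mu^2}\frac{t}{(t+E-1)^2}+O\Big(\frac{\ln t}{(t+E-1)^2}\Big),$$ where $N=2\mathbb{E}[\|\nabla f(w_*;\xi)\|^2]$ and $w_*=\arg\min_wF(w)$.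
   Context: Problem: minimize $F(w)=\mathbb{E}[f(w;\xi)]$ over $w\in\mathbb{R}^d$, where $\xi$ is a random variable and $\mathbb{E}[\nabla f(w;\xi)]=\nabla F(w)$ for every fixed $w$. Norms are Euclidean. $\mu$-strong convexity: $F(w)-F(w')\ge\langle\nabla F(w'),w-w'\rangle+\frac{\mu}{2}\|w-w'\|^2$ for all $w,w'$. $L$-smoothness (with $L>0$ the same for every realization of $\xi$): $\|\nabla f(w;\xi)-\nabla f(w';\xi)\|\le L\|w-w'\|$ for all $w,w'$. Filters: $D_\xi$ is the diagonal 0/1 matrix whose $i$-th diagonal entry is 1 if and only if there exists a $w$ such that the $i$-th position of $\nabla f(w;\xi)$ is non-zero (it is also identified with the set of these positions), and $|D_\xi|$ is its number of ones. A positive integer $D$ is fixed. For each $\xi$, non-empty (non-zero) diagonal 0/1 matrices $S^\xi_u$ are fixed a priori with $\sum_uS^\xi_u=D_\xi$, each having $\lfloor|D_\xi|/D\rfloor$ or $\lceil|D_\xi|/D\rceil$ ones on its diagonal; there are $D$ of them if $D\le|D_\xi|$, and $|D_\xi|$ of them (each with a single one) if $D>|D_\xi|$. The number of matrices $S^\xi_u$ is denoted $d_\xi$. In each iteration a random sample $\xi_t$ is drawn (the $\xi_t$ are i.i.d. copies of $\xi$) and one of the matrices $S^{\xi_t}_{u_t}$ is chosen uniformly, so that $d_\xi\mathbb{E}[S^\xi_u\mid\xi]=D_\xi$, the expectation being over $u$. In the iteration, the vector entries at those positions where $S^{\xi_t}_{u_t}$ has a 1 on its diagonal are updated; each such update is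 a single vector entry update. The starting point is $w_0\in\mathbb{R}^d$. Delay: several cores run the recursion in parallel on a vector in shared memory; $\hat w_t$ is the vector, read entry by entry and possibly inconsistently from shared memory, at which the gradient is computed. Shared memory is consistent with delay $\tau$ if, for all $t$, $\hat w_t$ includes the aggregate of the updates up to and including those made during the $(t-\tau)$-th iteration (the recursion above defining the $(t+1)$-st iteration), and each position read and each position update is atomic (it cannot be interrupted by another update to the same position). Thus $\hat w_t$ equals $w_{t-\tau}$ plus some subset of the later position updates, i.e. $$\hat w_t=w_{t-\tau}-\sum_{j=t-\tau}^{t-1}\eta_jd_{\xi_j}\Sigma_{t,j}S^{\xi_j}_{u_j}\nabla f(\hat w_j;\xi_j)$$ for some diagonal 0/1 matrices $\Sigma_{t,j}$, where $t-\tau$ is read as $\max\{t-\tau,0\}$. The $O(\cdot)$ terms refer to $t\to\infty$.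
   Formalization: The expected number of entry updates is shown to be at most t', with equality if almost surely every filter has exactly ⌈|D_ξ|/D⌉ ones; the unconditional equality fails, e.g. for |D_ξ|=3, D=2 (3/2 updates per iteration, not 2). *)

(* Defs.v *)
(* MathComp + MathComp-Analysis *)
From HB Require Import structures.
From mathcomp Require Import all_boot all_order all_algebra.
From mathcomp Require Import all_classical all_reals all_analysis.
Set Implicit Arguments.
Unset Strict Implicit.
Unset Printing Implicit Defensive.
Import Order.TTheory GRing.Theory Num.Theory.
Import numFieldNormedType.Exports.
Local Open Scope classical_set_scope.
Local Open Scope ring_scope.

Section euclidean.
Context {R : realType} {n : nat}.
Implicit Types v w : 'rV[R]_n.

Definition vdot v w : R := \sum_(i < n) v 0 i * w 0 i.

(* The library norm on ['rV[R]_n] is the sup norm; it induces the same notion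
   of differentiability. *)
Definition enorm v : R := Num.sqrt (vdot v v).

Definition grad (g : 'rV[R]_n -> R) w : 'rV[R]_n :=
  \row_(i < n) 'D_(delta_mx 0 i) g w.

Definition strongly_convex (mu : R) (F : 'rV[R]_n -> R) : Prop :=
  forall w w', F w - F w' >= vdot (grad F w') (w - w')
                            + mu / 2 * enorm (w - w') ^+ 2.

Definition smooth (L : R) (g : 'rV[R]_n -> R) : Prop :=
  forall w w', enorm (grad g w - grad g w') <= L * enorm (w - w').

Definition diag01 (A : {set 'I_n}) : 'M[R]_n :=
  diag_mx (\row_(i < n) (i \in A)%:R).

Definition grad_support (g : 'rV[R]_n -> R) : {set 'I_n} :=
  [set i | `[< exists w, grad g w 0 i != 0 >]].

End euclidean.

Definition ceil_divn (m k : nat) : nat := (m %/ k + ~~ (k %| m))%N.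

Section objective.
Context {R : realType} {n : nat} {d : measure_display} {X : measurableType d}.
Variables (Q : probability X R) (f : 'rV[R]_n -> X -> R).

(* [Q] is the law of the random variable written xi, so that an expectation
   over xi of g(xi) is ['E_Q[g]]. *)
Definition objective (w : 'rV[R]_n) : R := fine 'E_Q[f w]%E.

Definition unbiased_gradient : Prop :=
  forall w i,
    Q.-integrable setT (fun x => (grad (f^~ x) w 0 i)%:E) /\
    'E_Q[fun x => (grad (f^~ x) w 0 i)%R]%E = (grad objective w 0 i)%:E.

Definition Dxi (x : X) : {set 'I_n} := grad_support (f^~ x).

(* [S x] lists the sets of positions of the filters attached to [x], and
   [size (S x)] is their number; the u-th one is [nth finset.set0 (S x) u]. *)
Definition filter_family (D : nat) (S : X -> seq {set 'I_n}) : Prop :=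
  (forall s, measurable [set x | S x = s]) /\
  forall x,
    [/\ size (S x) = (if (D <= #|Dxi x|)%N then D else #|Dxi x|),
        finset.set0 \notin S x,
        forall A, A \in S x ->
          #|A| = (#|Dxi x| %/ D)%N \/ #|A| = ceil_divn #|Dxi x| D
      & \sum_(A <- S x) diag01 A = diag01 (Dxi x) :> 'M[R]_n].

End objective.

Section hogwild.
Context {R : realType} {n : nat} {d : measure_display} {X : measurableType d}.
Context {d' : measure_display} {Omega : measurableType d'}.
Variables (P : probability Omega R) (Q : probability X R).
Variables (f : 'rV[R]_n -> X -> R) (S : X -> seq {set 'I_n}).
Variables (xi : nat -> {RV P >-> X}) (u : nat -> {RV P >-> nat}).
Variable Sigma : nat -> nat -> Omega -> {set 'I_n}.

Definition sample_events (t : nat) : set (set Omega) :=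
  preimage_set_system setT (xi t) measurable `|`
  preimage_set_system setT (u t) measurable.

(* The events of the iterations before the t-th one: samples, chosen filters,
   and the read patterns [Sigma s j] that determine the vector read from the
   shared memory in iteration s. *)
Definition history (t : nat) : set (set Omega) :=
  <<s \bigcup_(s in `I_t)
        (sample_events s `|`
         \bigcup_(j in setT) preimage_set_system setT (Sigma s j) setT) >>.

Definition independent (G H : set (set Omega)) : Prop :=
  forall A B, G A -> H B -> P (A `&` B) = (P A * P B)%E.

(* In [uniform], [u t] is uniform on the d_xi filter indices conditionally on
   [xi t]; nothing is required where D_xi is empty, as there is then no filter
   and the update vanishes. *)
Record fresh_sampling : Prop := {
  identically_distributed : forall t A, measurable A ->
    distribution P (xi t) A = Q A;
  uniform : forall t (A : set X) (m k : nat), measurable A ->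
    A `<=` [set x | size (S x) = m] -> (k < m)%N ->
    P (xi t @^-1` A `&` u t @^-1` [set k])
      = ((m%:R^-1)%:E * P (xi t @^-1` A))%E;
  measurable_read : forall t j B, measurable (Sigma t j @^-1` B);
  fresh : forall t, independent (history t) <<s sample_events t >> }.

Definition chosen_filter (t : nat) (o : Omega) : {set 'I_n} :=
  nth finset.set0 (S (xi t o)) (u t o).

(* Gradients are row vectors, so matrices act on the right. *)
Definition update (eta : nat -> R) (what : nat -> Omega -> 'rV[R]_n)
    (t : nat) (o : Omega) : 'rV[R]_n :=
  (eta t * (size (S (xi t o)))%:R) *:
    (grad (f^~ (xi t o)) (what t o) *m diag01 (chosen_filter t o)).

Definition hogwild_recursion (eta : nat -> R) (w0 : 'rV[R]_n)
    (w what : nat -> Omega -> 'rV[R]_n) : Prop :=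
  (forall o, w 0%N o = w0) /\
  forall t o, w t.+1 o = w t o - update eta what t o.

(* Truncated subtraction makes [t - tau] equal to max(t - tau, 0). *)
Definition consistent_with_delay (tau : nat) (eta : nat -> R)
    (w what : nat -> Omega -> 'rV[R]_n) : Prop :=
  forall t o, what t o = w (t - tau)%N o
    - \sum_(t - tau <= j < t) update eta what j o *m diag01 (Sigma t j o).

(* The conditional mean of one summand given xi is |D_xi| / d_xi, which is at
   most the ceiling of |D_xi| / D, with equality if and only if all filters
   attached to xi have that number of ones. *)
Definition entry_updates (t : nat) (o : Omega) : nat :=
  (\sum_(s < t) #|chosen_filter s o|)%N.

End hogwild.

(* Main.v *)
(* Write x = w_t - wstar, G_t(v) = d S grad f(v; xi_t) for the filtered gradient
   of iteration t, and delta_t = E |what_t - w_t|^2. The read pattern of iteration t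
   may depend on (xi_t, u_t), so what_t need not be independent of the sample,
   but w_t is. Therefore the cross term is evaluated at w_t, where it has
   expectation <grad F(w_t), x> >= (mu / 2) |x|^2, and moving from w_t to what_t
   costs O(eta_t delta_t) by smoothness. The noise is G_t(wstar), whose second
   moment is at most D N / 2, which gives
     E |w_{t+1} - wstar|^2 <= (1 - 3 mu eta_t / 4) E |w_t - wstar|^2
        + O(eta_t delta_t) + eta_t^2 (D N + O(E |what_t - wstar|^2)).
   The moments are bounded because the step sizes tend to 0; hence
   delta_t = O(1 / t^2), and multiplying by (t + E)^2 turns the recursion into a
   telescoping one whose delay terms are O(1 / t) and sum up to O(ln t).
   If N is infinite only t = 0 carries information.

   The independence of w_t and (xi_t, u_t) is used on the countably many events
   on which w_t falls into a given cell of a mesh of width h, and h tends to 0. *)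

Require Import Defs.
From HB Require Import structures.
From mathcomp Require Import all_boot all_order all_algebra.
From mathcomp Require Import all_classical all_reals all_analysis.
From mathcomp Require Import measurable_realfun ring lra.
Set Implicit Arguments.
Unset Strict Implicit.
Unset Printing Implicit Defensive.
Import Order.TTheory GRing.Theory Num.Theory.
Import numFieldNormedType.Exports.
Local Open Scope classical_set_scope.
Local Open Scope ring_scope.

(** The gradient is only known to be measurable in [x] at each fixed point and Lipschitz in the
    point, so even the measurability of [grad (f^~ (xi t o)) (what t o)] needs an approximation; the
    mesh of the independence argument serves here too. Expectations over a sample are transported
    for non-negative integrands, as extended integrals, where no integrability has to be shown
    first; signed quantities are split into positive and negative parts. No conditional expectation
    is formed: the uniform choice of the filter enters by summing over its index and over the number
    of filters.

    The factors [D ^ 2] and [2 ^ tau] are crude, but they occur only in terms of lower order; the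
    leading term rests on a sharper second moment of the filtered gradient at [wstar], with a single
    factor [D]. The delay bound involves the moments at earlier reads, so a uniform bound on these
    has to be bootstrapped from small step sizes before any rate is available. *)

Section squared_norm.
Context {R : realType} {n : nat}.
Implicit Types (v w : 'rV[R]_n) (A : {set 'I_n}).

Definition nsq v : R := \sum_(i < n) v 0 i ^+ 2.

Lemma nsq_ge0 v : 0 <= nsq v.
Proof. by apply: sumr_ge0 => i _; exact: sqr_ge0. Qed.

Lemma vdotvv v : vdot v v = nsq v.
Proof. by apply: eq_bigr => i _; rewrite expr2. Qed.

Lemma enorm_sq v : enorm v ^+ 2 = nsq v.
Proof. by rewrite /enorm vdotvv sqr_sqrtr// nsq_ge0. Qed.

Lemma enorm_ge0 v : 0 <= enorm v.
Proof. exact: sqrtr_ge0. Qed.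

Lemma nsqZ a v : nsq (a *: v) = a ^+ 2 * nsq v.
Proof. by rewrite mulr_sumr; apply: eq_bigr => i _; rewrite mxE exprMn. Qed.

Lemma nsqN v : nsq (- v) = nsq v.
Proof. by apply: eq_bigr => i _; rewrite mxE sqrrN. Qed.

Lemma nsq0 : nsq 0 = 0.
Proof. by apply: big1 => i _; rewrite mxE expr0n. Qed.

Lemma nsqBC v w : nsq (v - w) = nsq (w - v).
Proof. by rewrite -nsqN opprB. Qed.

Lemma coord_sq_le v i : v 0 i ^+ 2 <= nsq v.
Proof.
rewrite /nsq (bigD1 i)//= lerDl.
by apply: sumr_ge0 => j _; exact: sqr_ge0.
Qed.

Lemma nsqD v w : nsq (v + w) = nsq v + 2 * vdot v w + nsq w.
Proof.
rewrite /nsq /vdot mulr_sumr -!big_split/=; apply: eq_bigr => i _.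
by rewrite mxE; ring.
Qed.

Lemma vdot_young e v w : 0 < e -> 2 * vdot v w <= e * nsq v + e^-1 * nsq w.
Proof.
move=> e0; rewrite /vdot /nsq !mulr_sumr -big_split/=.
apply: ler_sum => i _; rewrite -subr_ge0.
have -> : e * v 0 i ^+ 2 + e^-1 * w 0 i ^+ 2 - 2 * (v 0 i * w 0 i) =
          e * (v 0 i - e^-1 * w 0 i) ^+ 2.
  by field; rewrite gt_eqF.
by rewrite mulr_ge0 ?sqr_ge0// ltW.
Qed.

Lemma vdotDl v v' w : vdot (v + v') w = vdot v w + vdot v' w.
Proof.
by rewrite /vdot -big_split/=; apply: eq_bigr => i _; rewrite mxE mulrDl.
Qed.

Lemma vdotDr v w w' : vdot v (w + w') = vdot v w + vdot v w'.
Proof.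
by rewrite /vdot -big_split/=; apply: eq_bigr => i _; rewrite mxE mulrDr.
Qed.

Lemma vdotNl v w : vdot (- v) w = - vdot v w.
Proof. by rewrite /vdot -sumrN; apply: eq_bigr => i _; rewrite mxE mulNr. Qed.

Lemma vdotNr v w : vdot v (- w) = - vdot v w.
Proof. by rewrite /vdot -sumrN; apply: eq_bigr => i _; rewrite mxE mulrN. Qed.

Lemma vdotZl a v w : vdot (a *: v) w = a * vdot v w.
Proof. by rewrite /vdot mulr_sumr; apply: eq_bigr => i _; rewrite mxE mulrA.
  Qed.

Lemma nsqD_le v w : nsq (v + w) <= 2 * nsq v + 2 * nsq w.
Proof.
have := vdot_young v w (@ltr01 R).
by rewrite nsqD invr1 !mul1r; lra.
Qed.

(** Repeated halving by [nsqD_le]. The factor [2 ^ k] is not sharp, but the sums that occur have at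
    most [tau] terms and [tau] is constant. *)
Lemma nsq_sum_le (k m : nat) (F : nat -> 'rV[R]_n) :
  nsq (\sum_(m <= j < m + k) F j) <=
  2 ^+ k * \sum_(m <= j < m + k) nsq (F j).
Proof.
elim: k => [|k IH]; first by rewrite addn0 !big_geq// nsq0 mulr0.
rewrite addnS !big_nat_recr ?leq_addr//= exprS.
apply: (le_trans (nsqD_le _ _)).
have F0 := nsq_ge0 (F (m + k)%N).
have : (1 : R) <= 2 ^+ k by rewrite exprn_ege1// ler1n.
move: IH; set a := nsq _; set b := \sum_(_ <= _ < _) _; set c := (2 ^+ k : R).
by move=> IH c1; nra.
Qed.

Lemma mul_diag01E v A i : (v *m diag01 A) 0 i = v 0 i * (i \in A)%:R.
Proof. by rewrite /diag01 mul_mx_diag !mxE. Qed.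

Lemma nsq_diag01 v A : nsq (v *m diag01 A) = \sum_(i < n) v 0 i ^+ 2 * (i \in
  A)%:R.
Proof.
apply: eq_bigr => i _; rewrite mul_diag01E exprMn.
by case: (i \in A); rewrite ?expr1n ?expr0n.
Qed.

Lemma nsq_diag01_le v A : nsq (v *m diag01 A) <= nsq v.
Proof.
rewrite nsq_diag01; apply: ler_sum => i _.
by case: (i \in A); rewrite ?mulr1 ?mulr0 ?sqr_ge0.
Qed.

Lemma vdot_diag01 v w A :
  vdot (v *m diag01 A) w = \sum_(i < n) v 0 i * (i \in A)%:R * w 0 i.
Proof. by apply: eq_bigr => i _; rewrite mul_diag01E. Qed.

Lemma smooth_sq L (g : 'rV[R]_n -> R) v w : smooth L g ->
  nsq (grad g v - grad g w) <= L ^+ 2 * nsq (v - w).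
Proof.
move=> /(_ v w) sm; rewrite -!enorm_sq -exprMn; apply: lerXn2r => //.
  by rewrite nnegrE enorm_ge0.
by rewrite nnegrE (le_trans _ sm)// enorm_ge0.
Qed.

(** Strong convexity is applied with base point [v], and minimality only as [F wstar <= F v]. The
    gradient at [wstar] does not enter, which is why the constant is [mu / 2] and not [mu]. *)
Lemma strongly_convex_vdot mu F v wstar :
    strongly_convex mu F -> (forall w, F wstar <= F w) ->
  mu / 2 * nsq (v - wstar) <= vdot (grad F v) (v - wstar).
Proof.
move=> /(_ wstar v); rewrite enorm_sq nsqBC -(opprB v) vdotNr => scF /(_ v).
by lra.
Qed.

End squared_norm.

(** * Transport of non-negative integrals between measures *)

Section measure_transfer.
Local Open Scope ereal_scope.
Context {R : realType}.

Lemma ge0_integral_mrestr d (T : measurableType d)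
    (P : {measure set T -> \bar R}) (A : set T) (mA : measurable A)
    (h : T -> \bar R) :
  measurable_fun setT h -> (forall x, 0 <= h x) ->
  \int[mrestr P mA]_x h x = \int[P]_(x in A) h x.
Proof.
move=> mh h0.
have mAC : measurable (~` A) by exact: measurableC.
rewrite -(setUv A) ge0_integral_setU//=; last 2 first.
- by rewrite setUv.
- by apply/disj_set2P; exact: setICr.
rewrite [X in X + _](eq_measure_integral P); last first.
  by move=> B _ BA; rewrite /= /mrestr setIidl.
rewrite [X in _ + X](eq_measure_integral mzero); last first.
  move=> B _ BA; rewrite /= /mrestr.
  suff -> : B `&` A = set0 by rewrite measure0.
  by rewrite -subset0 => x [/BA].
by rewrite integral_measure_zero adde0.
Qed.

(** Both sides are integrals of [h] against the image of a restricted measure, and the hypothesis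
    says that the two images are proportional. The cases of interest are equal laws ([c = 1]), the
    uniform choice among [m] filters ([c = 1 / m]) and independence from an event [A]
    ([c = P A]). *)
Lemma ge0_integral_transfer d1 (T1 : measurableType d1)
    d2 (T2 : measurableType d2) d3 (Y : measurableType d3)
    (P1 : {measure set T1 -> \bar R}) (P2 : {measure set T2 -> \bar R})
    (z1 : T1 -> Y) (z2 : T2 -> Y) (A1 : set T1) (A2 : set T2) (c : R)
    (h : Y -> \bar R) :
    measurable_fun setT z1 -> measurable_fun setT z2 ->
    measurable A1 -> measurable A2 -> (0 <= c)%R ->
    (forall B, measurable B ->
      P1 (A1 `&` z1 @^-1` B) = c%:E * P2 (A2 `&` z2 @^-1` B)) ->
    measurable_fun setT h -> (forall y, 0 <= h y) ->
  \int[P1]_(x in A1) h (z1 x) = c%:E * \int[P2]_(x in A2) h (z2 x).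
Proof.
move=> mz1 mz2 mA1 mA2 c0 zE mh h0.
have push d' (T : measurableType d') (P : {measure set T -> \bar R}) z A
    (mz : measurable_fun setT z) (mA : measurable A) :
    \int[P]_(x in A) h (z x) = \int[pushforward (mrestr P mA) z]_y h y.
  rewrite [RHS](ge0_integral_pushforward mz)// preimage_setT
    ge0_integral_mrestr//.
    exact: measurableT_comp.
  by move=> x; exact: h0.
rewrite (push _ _ _ _ _ mz1 mA1) (push _ _ _ _ _ mz2 mA2).
rewrite -(@ge0_integral_mscale _ _ _ _ _ measurableT (NngNum c0))//.
apply: eq_measure_integral => B mB _.
by rewrite /= /mscale /pushforward /mrestr /= setIC zE// setIC.
Qed.

Lemma ge0_integral_cells d (T : measurableType d)
    (P : {measure set T -> \bar R}) (A : set T) (c : T -> nat)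
    (h : T -> \bar R) :
    measurable A -> (forall k, measurable (c @^-1` [set k])) ->
    measurable_fun setT h -> (forall x, 0 <= h x) ->
  \int[P]_(x in A) h x =
  \sum_(k <oo) \int[P]_(x in A `&` c @^-1` [set k]) h x.
Proof.
move=> mA mc mh h0.
have {1}-> : A = \bigcup_k (A `&` c @^-1` [set k]).
  by apply/seteqP; split=> [x Ax|x [k _ []]//]; exists (c x).
rewrite ge0_integral_bigcup//.
- by move=> k; exact: measurableI.
- exact: measurable_funTS.
- by move=> i j _ _ [x [[_ <-] [_ <-]]].
Qed.

Lemma ge0_le_integral_cells d (T : measurableType d)
    (P : {measure set T -> \bar R}) (c : T -> nat) (f h : T -> \bar R) :
    (forall k, measurable (c @^-1` [set k])) ->
    measurable_fun setT f -> (forall x, 0 <= f x) ->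
    measurable_fun setT h -> (forall x, 0 <= h x) ->
    (forall k, \int[P]_(x in c @^-1` [set k]) f x <=
               \int[P]_(x in c @^-1` [set k]) h x) ->
  \int[P]_x f x <= \int[P]_x h x.
Proof.
move=> mc mf f0 mh h0 fh.
rewrite (ge0_integral_cells P measurableT mc mf f0).
rewrite (ge0_integral_cells P measurableT mc mh h0).
apply: lee_nneseries => k _.
- by move=> _; apply: integral_ge0.
- by rewrite setTI.
Qed.

End measure_transfer.

Section countable_index.

(** The preimage splits into countably many pieces, one for each value of the index. The index will
    be a list of filters, a filter number, a read pattern or a mesh cell. *)
Lemma measurable_countable_comp d1 (T : measurableType d1)
    d2 (X : measurableType d2) d3 (Y : measurableType d3) (I : countType)
    (c : T -> I) (z : T -> X) (F : I -> X -> Y) :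
    (forall i, measurable (c @^-1` [set i])) -> measurable_fun setT z ->
    (forall i, measurable_fun setT (F i)) ->
  measurable_fun setT (fun o => F (c o) (z o)).
Proof.
move=> mc mz mF _ B mB; rewrite setTI.
have -> : (fun o => F (c o) (z o)) @^-1` B =
    \bigcup_(i in [set: I]) (c @^-1` [set i] `&` (F i \o z) @^-1` B).
  by apply/seteqP; split=> [t FB|t [i _ [] <-]//]; exists (c t).
apply: countable_bigcupT_measurable => [|i]; first exact: countableP.
apply: measurableI => //.
by rewrite -[X in measurable X]setTI; apply: measurableT_comp.
Qed.

End countable_index.

(** * Rounding to a mesh, and composition with functions Lipschitz in one argument *)

Section rounding.
Context {R : realType} {n : nat}.
Implicit Types (h : R) (v : 'rV[R]_n) (q : 'rV[int]_n).

(** The cell is kept as an integer vector, since this type is countable: unions over cells stay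
    measurable and integrals split into series. [mesh_point] then gives the lower corner of the cell
    as a representative. *)
Definition mesh_cell h v : 'rV[int]_n := \row_i Num.floor (v 0 i / h).

Definition mesh_point h q : 'rV[R]_n := \row_i (h * (q 0 i)%:~R).

Lemma nsq_mesh_point h v : 0 < h ->
  nsq (v - mesh_point h (mesh_cell h v)) <= n%:R * h ^+ 2.
Proof.
move=> h0; rewrite -[n in n%:R]card_ord mulr_natl -sumr_const.
apply: ler_sum => i _; rewrite !mxE.
set m := Num.floor _.
have /andP[m1 m2] : m%:~R <= v 0 i / h < m%:~R + 1.
  by rewrite -[1]/(1%:~R) -intrD Num.Theory.floor_le Num.Theory.floorD1_gt.
rewrite ler_pdivlMr// in m1; rewrite ltr_pdivrMr// in m2.
rewrite -ler_sqrt ?sqr_ge0// !sqrtr_sqr (gtr0_norm h0) ger0_norm; nra.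
Qed.

Lemma measurable_mesh_cell d (T : measurableType d) h (W : T -> 'rV[R]_n) q :
    (forall i, measurable_fun setT (fun t => W t 0 i)) ->
  measurable ((mesh_cell h \o W) @^-1` [set q]).
Proof.
move=> mW.
have -> : (mesh_cell h \o W) @^-1` [set q] = \bigcap_(i in [set: 'I_n])
    ((fun t => W t 0 i / h) @^-1` `[(q 0 i)%:~R, (q 0 i + 1)%:~R[).
  apply/seteqP; split => [t /= <- i _|t /= Wq].
    by rewrite /= in_itv/= mxE Num.Theory.floor_le Num.Theory.floorD1_gt.
  apply/rowP => i; rewrite mxE; apply: Num.Theory.floor_def.
  by have /= := Wq i I; rewrite in_itv.
apply: fin_bigcap_measurable => [|i _]; first exact: finite_finset.
rewrite -[X in measurable X]setTI.
apply: (measurable_funM (mW i) (measurable_cst h^-1)) => //.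
Qed.

End rounding.

(** Once [W] is rounded to a mesh of width [1 / (k + 1)], only countably many functions [g v] are
    involved. The Lipschitz bound makes these compositions converge pointwise to the original
    one. *)
Lemma measurable_caratheodory (R : realType) (n : nat)
    d1 (T : measurableType d1) d2 (X : measurableType d2) (L : R)
    (W : T -> 'rV[R]_n) (z : T -> X) (g : 'rV[R]_n -> X -> R) :
    (forall i, measurable_fun setT (fun t => W t 0 i)) ->
    measurable_fun setT z ->
    (forall v, measurable_fun setT (g v)) ->
    (forall v w x, (g v x - g w x) ^+ 2 <= L * nsq (v - w)) ->
  measurable_fun setT (fun t => g (W t) (z t)).
Proof.
move=> mW mz mg Lg.
pose p (k : nat) t := mesh_point (k.+1%:R^-1 : R) (mesh_cell k.+1%:R^-1 (W t)).
apply: (measurable_fun_cvg (h := fun k t => g (p k t) (z t))) => [k|t _].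
  apply: (measurable_countable_comp (c := mesh_cell k.+1%:R^-1 \o W)
    (F := fun q => g (mesh_point k.+1%:R^-1 q))) => // q.
  exact: measurable_mesh_cell.
apply/cvgrPdist_le => e e0.
pose C := `|L| * n%:R.
have C0 : 0 <= C by rewrite mulr_ge0.
have C1 : 0 < 1 + C by rewrite ltr_wpDr.
have eC0 : 0 < e / (1 + C) by rewrite divr_gt0.
near=> k; set h := k.+1%:R^-1 : R.
have h0 : 0 < h by rewrite invr_gt0.
(* The squared difference is at most [C * h ^ 2], and [C <= (1 + C) ^ 2] avoids taking a square root
   of [C]. *)
apply: (@le_trans _ _ ((1 + C) * h)).
  rewrite -ler_sqr ?nnegrE ?mulr_ge0 ?(ltW h0) ?(ltW C1)// real_normK
    ?num_real//.
  apply: (le_trans (Lg _ _ _)); have Wh := nsq_mesh_point (W t) h0.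
  apply: (@le_trans _ _ (C * h ^+ 2)).
    rewrite -mulrA; apply: (@le_trans _ _ (`|L| * nsq (W t - p k t))).
      by rewrite ler_wpM2r ?nsq_ge0 ?ler_norm.
    by rewrite ler_wpM2l.
  by rewrite exprMn ler_wpM2r ?sqr_ge0//; nra.
rewrite mulrC -ler_pdivlMr//; apply: ltW.
by rewrite /h; near: k; exact: (near_infty_natSinv_lt (PosNum eC0)).
Unshelve. all: by end_near. Qed.

(** * Measurability and counting for the filters *)

Section filters.
Context {R : realType} {n : nat} {d : measure_display} {X : measurableType d}.
Context (f : 'rV[R]_n -> X -> R) (D : nat) (S : X -> seq {set 'I_n}).
Hypothesis fS : filter_family f D S.

(** [S] has measurable fibres and values in a countable type, so every function of [S x] is
    measurable in [x]. *)
Lemma measurable_filters d' (Y : measurableType d') (g : seq {set 'I_n} -> Y) :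
  measurable_fun setT (g \o S).
Proof.
apply: (measurable_countable_comp (c := S) (z := @id X) (F := fun s _ => g s)).
- by case: fS.
- exact: measurable_id.
- by move=> s; exact: measurable_cst.
Qed.

Lemma size_filters_le x : (size (S x) <= D)%N.
Proof.
have [_ /(_ x)[-> _ _ _]] := fS.
by case: (leqP D) => // /ltnW.
Qed.

Lemma sum_mem_filters x i :
  \sum_(A <- S x) (i \in A)%:R = (i \in Dxi f x)%:R :> R.
Proof.
have [_ /(_ x)[_ _ _ /matrixP/(_ i i)]] := fS.
rewrite summxE /diag01 !mxE eqxx mulr1n => <-.
by apply: eq_bigr => A _; rewrite !mxE eqxx mulr1n.
Qed.

(** Beyond the end of the list [nth] returns the empty set. With this padding the range of summation
    no longer depends on [x], and the sum can be exchanged with an integral. *)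
Lemma sum_mem_nth_filters x i :
  \sum_(k < D) (i \in nth finset.set0 (S x) k)%:R = (i \in Dxi f x)%:R :> R.
Proof.
rewrite -sum_mem_filters (big_nth finset.set0) big_mkord.
rewrite (big_ord_widen D (fun k => (i \in nth finset.set0 (S x) k)%:R : R)
  (size_filters_le x)).
rewrite [RHS]big_mkcond/=; apply: eq_bigr => k _.
by case: ltnP => // ?; rewrite nth_default// finset.in_set0.
Qed.

Lemma sum_mem_card (A : {set 'I_n}) : \sum_(i < n) (i \in A)%:R = #|A|%:R :> R.
Proof. by rewrite -natr_sum -sum1_card [in RHS]big_mkcond. Qed.

(** Besides the count itself, this exhibits [#|Dxi f x|] as a function of [S x], which yields its
    measurability. *)
Lemma card_Dxi x : #|Dxi f x| = (\sum_(A <- S x) #|A|)%N.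
Proof.
apply/eqP; rewrite -(eqr_nat R) natr_sum -sum_mem_card; apply/eqP.
rewrite (eq_bigr _ (fun i _ => esym (sum_mem_filters x i))) exchange_big/=.
by apply: eq_bigr => A _; exact: sum_mem_card.
Qed.

Lemma card_filter_le x A : A \in S x -> (#|A| <= ceil_divn #|Dxi f x| D)%N.
Proof.
have [_ /(_ x)[_ _ cardS _]] := fS.
by move=> /cardS[] ->//; rewrite leq_addr.
Qed.

Lemma measurable_ceil_card_Dxi :
  measurable_fun setT (fun x => (ceil_divn #|Dxi f x| D)%:R : R).
Proof.
under eq_fun do rewrite card_Dxi.
exact: (measurable_filters (fun s => (ceil_divn (\sum_(A <- s) #|A|) D)%:R :
  R)).
Qed.

End filters.

(** * Law of the sample and of the chosen filter *)

Section sampling_law.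
Context {R : realType} {n : nat} {d : measure_display} {X : measurableType d}.
Context {d' : measure_display} {Omega : measurableType d'}.
Context (P : probability Omega R) (Q : probability X R).
Context (f : 'rV[R]_n -> X -> R) (D : nat) (S : X -> seq {set 'I_n}).
Context (xi : nat -> {RV P >-> X}) (u : nat -> {RV P >-> nat}).
Context (Sigma : nat -> nat -> Omega -> {set 'I_n}).
Hypothesis fS : filter_family f D S.
Hypothesis freshP : fresh_sampling Q S xi u Sigma.

Lemma ge0_integral_sample t (h : X -> \bar R) :
    measurable_fun setT h -> (forall x, 0 <= h x)%E ->
  (\int[P]_o h (xi t o) = \int[Q]_x h x)%E.
Proof.
move=> mh h0; rewrite -[RHS]mul1e.
apply: (@ge0_integral_transfer _ _ _ _ _ _ _ P Q (xi t) id) => //.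
move=> B mB; rewrite !setTI mul1e.
exact: (identically_distributed freshP t mB).
Qed.

(* The factor [size (S x)] compensates the probability of picking one of the
   filters of [x], which partition the support of the gradient. *)
Lemma ge0_integral_chosen t i (b : X -> R) :
    measurable_fun setT b -> (forall x, 0 <= b x) ->
  (\int[P]_o ((size (S (xi t o)))%:R * b (xi t o) *
              (i \in chosen_filter S xi u t o)%:R)%:E =
   \int[Q]_x (b x * (i \in Dxi f x)%:R)%:E)%E.
Proof.
move=> mb b0.
pose e (k : nat) x : R := (i \in nth finset.set0 (S x) k)%:R.
have e0 k x : 0 <= e k x by rewrite /e ler0n.
have me k : measurable_fun setT (e k).
  exact: (measurable_filters fS (fun s => (i \in nth finset.set0 s k)%:R : R)).
pose sz x : R := (size (S x))%:R.
have msz : measurable_fun setT sz.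
  exact: (measurable_filters fS (fun s => (size s)%:R : R)).
pose H k x := sz x * b x * e k x.
have mH k : measurable_fun setT (H k).
  by apply: measurable_funM => //; exact: measurable_funM.
have H0 k x : 0 <= H k x by rewrite !mulr_ge0 ?ler0n.
have mu k : measurable (u t @^-1` [set k]).
  by rewrite -[X in measurable X]setTI; exact: measurable_funP.
have mxi A : measurable A -> measurable (xi t @^-1` A).
  by move=> mA; rewrite -[X in measurable X]setTI; exact: measurable_funP.
have mm m : measurable [set x | size (S x) = m].
  rewrite -[X in measurable X]setTI.
  exact: (measurable_filters fS (size : seq {set 'I_n} -> nat) measurableT
    (I : measurable [set m])).
(* Decomposition by the chosen index [k]. An index [u t o >= D] is out of range, the chosen filter
   is then empty and contributes nothing. *)
transitivity (\sum_(k < D) \int[P]_(o in u t @^-1` [set (k : nat)]) (H k (xi t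
  o))%:E)%E.
  transitivity (\int[P]_o (\sum_(k < D) (H k (xi t o) * \1_(u t @^-1` [set (k :
    nat)]) o)%:E))%E.
    apply: eq_integral => o _; rewrite sumEFin; congr EFin.
    have [uD|uD] := ltnP (u t o) D.
      rewrite (bigD1 (Ordinal uD))//= indicE mem_set// mulr1 big1 ?addr0// => k
        kN.
      rewrite indicE memNset ?mulr0// => /= uk.
      by move: kN; rewrite -val_eqE/= uk eqxx.
    rewrite /chosen_filter nth_default ?(leq_trans (size_filters_le fS _))//.
    rewrite finset.in_set0 mulr0 big1// => k _.
    rewrite indicE memNset ?mulr0// => /= uk.
    by move: uD; rewrite uk leqNgt ltn_ord.
  rewrite ge0_integral_sum//.
  - apply: eq_bigr => k _; rewrite [RHS]integral_mkcond; apply: eq_integral => o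
    _.
    rewrite patchE indicE; case: (o \in _); rewrite ?mulr1 ?mulr0//.
  - move=> k; apply/measurable_EFinP; apply: measurable_funM => //.
    exact: measurableT_comp.
  - by move=> k o _; rewrite lee_fin mulr_ge0.
transitivity (\sum_(k < D) \int[Q]_x (b x * e k x)%:E)%E; last first.
  rewrite -ge0_integral_sum//.
  - apply: eq_integral => x _; rewrite sumEFin -mulr_sumr.
    by rewrite (sum_mem_nth_filters fS).
  - by move=> k; apply/measurable_EFinP; exact: measurable_funM.
  - by move=> k x _; rewrite lee_fin mulr_ge0.
apply: eq_bigr => k _.
(* The probability of an index is known only on sets of samples with a fixed number [m] of filters,
   hence a second decomposition, by [m]. For [k < m] the probability [1 / m] cancels the factor
   [size (S x) = m]; for [k >= m] both sides vanish. *)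
rewrite (ge0_integral_cells P (c := fun o => size (S (xi t o))))//; last first.
- by move=> o; rewrite lee_fin.
- by apply/measurable_EFinP; exact: measurableT_comp.
- by move=> m; exact: (mxi [set x | size (S x) = m]).
rewrite (ge0_integral_cells Q (c := fun x => size (S x)))//; last first.
- by move=> x; rewrite lee_fin mulr_ge0.
- by apply/measurable_EFinP; exact: measurable_funM.
apply: eq_eseriesr => m _; rewrite setTI.
have [km|mk] := ltnP k m; last first.
  rewrite [LHS]integral0_eq ?[RHS]integral0_eq//.
  - by move=> x /= Sm; rewrite /e nth_default ?Sm// finset.in_set0 mulr0.
  - by move=> o [_ /= Sm]; rewrite /H /e nth_default ?Sm// finset.in_set0 mulr0.
rewrite (@ge0_integral_transfer _ _ _ _ _ _ _ P Q (xi t) id _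
  [set x | size (S x) = m] m%:R^-1 (EFin \o H k))//; last 4 first.
- exact: measurableI (mu k) (mxi _ (mm m)).
- move=> B mB; rewrite -setIA setIC.
  have mmB := measurableI _ _ (mm m) mB.
  apply: (etrans (uniform freshP t mmB (@subIsetl _ _ _) km)).
  congr (_ * _)%E; exact: (identically_distributed freshP t mmB).
- exact/measurable_EFinP.
- by move=> x; rewrite lee_fin.
rewrite -ge0_integralZl//.
- apply: eq_integral => x /set_mem/= Sm; rewrite -EFinM /H /sz Sm.
  by rewrite !mulrA mulVf ?mul1r// pnatr_eq0 -lt0n (leq_ltn_trans _ km).
- by apply: measurable_funTS; exact/measurable_EFinP.
- by move=> x _; rewrite lee_fin.
Qed.

End sampling_law.

Section expected_updates.
Context {R : realType} {n : nat} {d : measure_display} {X : measurableType d}.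
Context {d' : measure_display} {Omega : measurableType d'}.
Context (P : probability Omega R) (Q : probability X R).
Context (f : 'rV[R]_n -> X -> R) (D : nat) (S : X -> seq {set 'I_n}).
Context (xi : nat -> {RV P >-> X}) (u : nat -> {RV P >-> nat}).
Context (Sigma : nat -> nat -> Omega -> {set 'I_n}).
Hypothesis fS : filter_family f D S.
Hypothesis freshP : fresh_sampling Q S xi u Sigma.

Lemma measurable_chosen d'' (Y : measurableType d'') t (g : {set 'I_n} -> Y) :
  measurable_fun setT (g \o chosen_filter S xi u t).
Proof.
apply: (measurable_countable_comp (c := u t) (z := xi t)
  (F := fun k x => g (nth finset.set0 (S x) k))) => // k.
  by rewrite -[X in measurable X]setTI; exact: measurable_funP.
exact: (measurable_filters fS (fun s => g (nth finset.set0 s k))).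
Qed.

Lemma measurable_mem_Dxi i :
  measurable_fun setT (fun x => (i \in Dxi f x)%:R : R).
Proof.
under eq_fun do rewrite -(sum_mem_filters fS).
exact: (measurable_filters fS (fun s => \sum_(A <- s) (i \in A)%:R : R)).
Qed.

Lemma measurable_card_Dxi :
  measurable_fun setT (fun x => #|Dxi f x|%:R : R).
Proof.
under eq_fun do rewrite (card_Dxi fS).
exact: (measurable_filters fS (fun s => (\sum_(A <- s) #|A|)%:R : R)).
Qed.

(** The cardinal is summed position by position, with the weight [b] chosen to cancel [size (S x)].
    Where there is no filter the cancellation fails, as [0^-1 = 0], but there the chosen filter is
    empty as well. *)
Lemma integral_card_chosen t :
  (\int[P]_o (#|chosen_filter S xi u t o|%:R)%:E =
   \int[Q]_x ((size (S x))%:R^-1 * #|Dxi f x|%:R)%:E)%E.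
Proof.
pose b x : R := (size (S x))%:R^-1.
have mb : measurable_fun setT b.
  exact: (measurable_filters fS (fun s => (size s)%:R^-1 : R)).
have b0 x : 0 <= b x by rewrite invr_ge0 ler0n.
transitivity (\sum_(i < n) \int[P]_o ((size (S (xi t o)))%:R * b (xi t o) *
    (i \in chosen_filter S xi u t o)%:R)%:E)%E.
  rewrite -ge0_integral_sum//.
  - apply: eq_integral => o _; rewrite sumEFin -sum_mem_card; congr EFin.
    apply: eq_bigr => i _; have [S0|S0] := eqVneq (size (S (xi t o))) 0%N.
      by rewrite S0 /chosen_filter nth_default ?S0// finset.in_set0 mulr0.
    by rewrite /b divff ?mul1r// pnatr_eq0.
  - move=> i; apply/measurable_EFinP; apply: measurable_funM.
      apply: measurable_funM; last exact: measurableT_comp.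
      exact: (measurableT_comp
        (measurable_filters fS (fun s => (size s)%:R : R))).
    exact: (measurable_chosen t (fun A => (i \in A)%:R : R)).
  - by move=> i o _; rewrite lee_fin !mulr_ge0 ?ler0n.
under eq_bigr => i _ do rewrite (ge0_integral_chosen fS freshP)//.
rewrite -ge0_integral_sum//.
- by apply: eq_integral => x _; rewrite sumEFin -mulr_sumr sum_mem_card.
- move=> i; apply/measurable_EFinP; apply: measurable_funM => //.
  exact: measurable_mem_Dxi.
- by move=> i x _; rewrite lee_fin !mulr_ge0 ?ler0n.
Qed.

Lemma expectation_entry_updates t :
  ('E_P[fun o => (entry_updates S xi u t o)%:R%R] =
   t%:R%:E * \int[Q]_x ((size (S x))%:R^-1 * #|Dxi f x|%:R)%:E)%E.
Proof.
rewrite unlock /entry_updates.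
under eq_integral do rewrite natr_sum -sumEFin.
rewrite ge0_integral_sum//.
  rewrite (eq_bigr _ (fun (s : 'I_t) _ => integral_card_chosen s)).
  rewrite sumr_const card_ord. by rewrite mule_natl.
move=> s; apply/measurable_EFinP.
exact: (measurable_chosen s (fun A => #|A|%:R : R)).
Qed.

(** By [card_Dxi] the left side is the mean of the cardinals of the filters of [x], each of which is
    at most the ceiling. *)
Lemma inv_size_card_Dxi_le x :
  (size (S x))%:R^-1 * #|Dxi f x|%:R <= (ceil_divn #|Dxi f x| D)%:R :> R.
Proof.
have [S0|S0] := posnP (size (S x)); first by rewrite S0 invr0 mul0r ler0n.
rewrite ler_pdivrMl ?ltr0n// -natrM ler_nat mulnC {1}(card_Dxi fS).
rewrite -[(_ * size _)%N]iter_addn_0 -count_predT -big_const_seq.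
rewrite big_seq [leqRHS]big_seq; apply: leq_sum => A.
exact: card_filter_le.
Qed.

Lemma inv_size_card_Dxi_eq x : (0 < D)%N ->
    (forall A, A \in S x -> #|A| = ceil_divn #|Dxi f x| D) ->
  (size (S x))%:R^-1 * #|Dxi f x|%:R = (ceil_divn #|Dxi f x| D)%:R :> R.
Proof.
move=> D0 cardS; have [S0|S0] := posnP (size (S x)).
  rewrite S0 invr0 mul0r.
  have -> : #|Dxi f x| = 0%N by rewrite (card_Dxi fS) (size0nil S0) big_nil.
  by rewrite /ceil_divn div0n dvdn0.
rewrite {1}(card_Dxi fS) big_seq (eq_bigr _ cardS) -big_seq.
rewrite big_const_seq count_predT iter_addn_0 mulnC natrM mulrA mulVf ?mul1r//.
by rewrite pnatr_eq0 -lt0n.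
Qed.

End expected_updates.

(** * Measurability of random vectors and of the iterates *)

Section measurable_vectors.
Context {R : realType} {n : nat} {d : measure_display} {T : measurableType d}.
Implicit Types V W : T -> 'rV[R]_n.

Definition measurable_vec V : Prop :=
  forall i, measurable_fun setT (fun o => V o 0 i).

Lemma measurable_vec_cst v : measurable_vec (cst v).
Proof. by move=> i; exact: measurable_cst. Qed.

Lemma measurable_vecD V W : measurable_vec V -> measurable_vec W ->
  measurable_vec (fun o => V o + W o).
Proof.
move=> mV mW i; under eq_fun do rewrite mxE.
by apply: measurable_funD; [exact: mV|exact: mW].
Qed.

Lemma measurable_vecN V : measurable_vec V -> measurable_vec (fun o => - V o).
Proof.
move=> mV i; under eq_fun do rewrite mxE.
by apply: measurableT_comp => //; exact: mV.
Qed.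

Lemma measurable_vecB V W : measurable_vec V -> measurable_vec W ->
  measurable_vec (fun o => V o - W o).
Proof. by move=> mV mW; apply: measurable_vecD => //; exact: measurable_vecN.
  Qed.

Lemma measurable_vec_scale (c : T -> R) V : measurable_fun setT c ->
  measurable_vec V -> measurable_vec (fun o => c o *: V o).
Proof.
move=> mc mV i; under eq_fun do rewrite mxE.
by apply: measurable_funM => //; exact: mV.
Qed.

Lemma measurable_vec_sum (r : seq nat) (V : nat -> T -> 'rV[R]_n) :
    (forall j, j \in r -> measurable_vec (V j)) ->
  measurable_vec (fun o => \sum_(j <- r) V j o).
Proof.
elim: r => [|j r IH] mV.
  by under eq_fun do rewrite big_nil; exact: measurable_vec_cst.
under eq_fun do rewrite big_cons.
apply: measurable_vecD; first by apply: mV; rewrite inE eqxx.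
by apply: IH => k kr; apply: mV; rewrite inE kr orbT.
Qed.

Lemma measurable_vec_diag01 V (A : T -> {set 'I_n}) : measurable_vec V ->
    (forall i, measurable_fun setT (fun o => (i \in A o)%:R : R)) ->
  measurable_vec (fun o => V o *m diag01 (A o)).
Proof.
move=> mV mA i; under eq_fun do rewrite mul_diag01E.
by apply: measurable_funM => //; exact: mV.
Qed.

Lemma measurable_vdot V W : measurable_vec V -> measurable_vec W ->
  measurable_fun setT (fun o => vdot (V o) (W o)).
Proof.
move=> mV mW; apply: measurable_sum => i.
by apply: measurable_funM; [exact: mV|exact: mW].
Qed.

Lemma measurable_nsq V : measurable_vec V ->
  measurable_fun setT (fun o => nsq (V o)).
Proof.
move=> mV; under eq_fun do rewrite -vdotvv.
exact: measurable_vdot.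
Qed.

Lemma measurable_vec_grad d2 (X : measurableType d2) L
    (f : 'rV[R]_n -> X -> R) V (z : T -> X) :
    (forall x, smooth L (f^~ x)) ->
    (forall v i, measurable_fun setT (fun x => grad (f^~ x) v 0 i)) ->
    measurable_vec V -> measurable_fun setT z ->
  measurable_vec (fun o => grad (f^~ (z o)) (V o)).
Proof.
move=> smf mf mV mz i.
apply: (measurable_caratheodory (L := L ^+ 2) (g := fun v x => grad (f^~ x) v 0
  i)) => //.
move=> v w x.
have -> : grad (f^~ x) v 0 i - grad (f^~ x) w 0 i =
    (grad (f^~ x) v - grad (f^~ x) w) 0 i by rewrite !mxE.
exact: le_trans (coord_sq_le _ _) (smooth_sq _ _ (smf x)).
Qed.

End measurable_vectors.

(** The sample [z] and the index [k] live on an arbitrary space, so that this also applies to the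
    two projections of [X * nat]. *)
Lemma measurable_scaled_filter (R : realType) (n : nat)
    d (X : measurableType d) d' (T : measurableType d')
    (f : 'rV[R]_n -> X -> R) (D : nat) (S : X -> seq {set 'I_n})
    (z : T -> X) (k : T -> nat) (v : T -> 'rV[R]_n) :
    filter_family f D S -> measurable_fun setT z -> measurable_fun setT k ->
    measurable_vec v ->
  measurable_vec (fun o => (size (S (z o)))%:R *:
    (v o *m diag01 (nth finset.set0 (S (z o)) (k o)))).
Proof.
move=> fS mz mk mv; apply: measurable_vec_scale.
  exact: (measurableT_comp (measurable_filters fS (fun s => (size s)%:R : R))
    mz).
apply: measurable_vec_diag01 => // i.
apply: (measurable_countable_comp (c := k) (z := z)
  (F := fun k x => (i \in nth finset.set0 (S x) k)%:R : R)) => // j.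
- by rewrite -[X in measurable X]setTI; exact: mk.
- exact: (measurable_filters fS (fun s => (i \in nth finset.set0 s j)%:R : R)).
Qed.

Section measurable_iterates.
Context {R : realType} {n : nat} {d : measure_display} {X : measurableType d}.
Context {d' : measure_display} {T : measurableType d'}.
Context (f : 'rV[R]_n -> X -> R) (D : nat) (S : X -> seq {set 'I_n}) (L : R).
Context (xi : nat -> T -> X) (u : nat -> T -> nat).
Context (Sigma : nat -> nat -> T -> {set 'I_n}).
Context (tau : nat) (eta : nat -> R) (w0 : 'rV[R]_n).
Context (w what upd : nat -> T -> 'rV[R]_n) (t : nat).
Hypothesis fS : filter_family f D S.
Hypothesis smf : forall x, smooth L (f^~ x).
Hypothesis mf : forall v i, measurable_fun setT (fun x => grad (f^~ x) v 0 i).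
Hypothesis updE : forall s o, upd s o = (eta s * (size (S (xi s o)))%:R) *:
  (grad (f^~ (xi s o)) (what s o) *m diag01 (nth finset.set0 (S (xi s o)) (u s
    o))).
Hypothesis wE : (forall o, w 0%N o = w0) /\
  forall s o, w s.+1 o = w s o - upd s o.
Hypothesis whatE : forall s o, what s o = w (s - tau)%N o -
  \sum_(s - tau <= j < s) upd j o *m diag01 (Sigma s j o).
Hypothesis mxi : forall s, (s < t)%N -> measurable_fun setT (xi s).
Hypothesis mu : forall s, (s < t)%N -> measurable_fun setT (u s).
Hypothesis mSigma : forall s j B, (s < t)%N -> measurable (Sigma s j @^-1` B).

(** The space [T] is arbitrary, and samples, indices and read patterns are assumed measurable only
    before time [t]. Hence [T] may be [Omega] with its own events, or [Omega] with only the events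
    of the history before [t]. In the latter case [w t] is covered but [what t] is not, since it
    depends on the read pattern of iteration [t]. *)
Lemma measurable_iterates s :
  ((s <= t)%N -> measurable_vec (w s)) /\
  ((s < t)%N -> measurable_vec (what s)).
Proof.
elim/ltn_ind: s => s IH.
have mupd j : (j < s)%N -> (s <= t)%N -> measurable_vec (upd j).
  move=> js st; have jt := leq_trans js st.
  have [_ /(_ jt) mwhat] := IH j js.
  have -> : upd j = (fun o => eta j *: ((size (S (xi j o)))%:R *:
      (grad (f^~ (xi j o)) (what j o) *m
       diag01 (nth finset.set0 (S (xi j o)) (u j o))))).
    by apply/funext => o; rewrite updE scalerA.
  apply: measurable_vec_scale; first exact: measurable_cst.
  apply: (measurable_scaled_filter fS (mxi jt) (mu jt)).
  exact: measurable_vec_grad smf mf mwhat (mxi jt).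
have mw : (s <= t)%N -> measurable_vec (w s).
  case: s => [|s] in IH mupd * => st.
    have -> : w 0%N = cst w0 by apply/funext; exact: wE.1.
    exact: measurable_vec_cst.
  rewrite (_ : w s.+1 = fun o => w s o - upd s o); last exact/funext/wE.2.
  apply: measurable_vecB; last exact: mupd.
  by have [/(_ (ltnW st))] := IH s (ltnSn s).
split=> // st; have st' := ltnW st.
rewrite (_ : what s = fun o => w (s - tau)%N o -
  \sum_(s - tau <= j < s) upd j o *m diag01 (Sigma s j o)); last
    exact/funext/whatE.
apply: measurable_vecB.
  have [->|] := eqVneq (s - tau)%N s; first exact: mw.
  move=> sN; have ss : (s - tau < s)%N by rewrite ltn_neqAle sN leq_subr.
  by apply: (IH _ ss).1; exact: leq_trans (ltnW ss) st'.
apply: measurable_vec_sum => j; rewrite mem_index_iota => /andP[_ js].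
apply: measurable_vec_diag01; first exact: mupd.
move=> i; apply: (measurable_countable_comp (c := Sigma s j) (z := @id T)
  (F := fun A _ => (i \in A)%:R : R)) => [A||A].
- exact: mSigma.
- exact: measurable_id.
- exact: measurable_cst.
Qed.

End measurable_iterates.

Lemma max0B (R : realDomainType) (x : R) :
  Num.max x 0 - Num.max (- x) 0 = x.
Proof.
have [x0|x0] := leP 0 x.
  have nx0 : - x <= 0 by rewrite oppr_le0.
  by rewrite (max_r nx0) subr0.
have nx0 : 0 <= - x by rewrite oppr_ge0 ltW.
by rewrite (max_l nx0) sub0r opprK.
Qed.

(** * Calculus of real integrable functions *)

Section integrable_real.
Context {R : realType} {d : measure_display} {T : measurableType d}.
Context (P : probability T R).
Implicit Types g h : T -> R.

Definition L1 g : Prop := P.-integrable setT (EFin \o g).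

Lemma L1_measurable g : L1 g -> measurable_fun setT g.
Proof. by move=> /(measurable_int P)/measurable_EFinP. Qed.

Lemma L1_dom g h : measurable_fun setT g -> (forall x, `|g x| <= h x) ->
  L1 h -> L1 g.
Proof.
move=> mg gh; apply: le_integrable => //; first exact/measurable_EFinP.
by move=> x _; rewrite /= lee_fin (le_trans (gh x))// ler_norm.
Qed.

Lemma L1_ge0_dom g h : measurable_fun setT g -> (forall x, 0 <= g x <= h x) ->
  L1 h -> L1 g.
Proof.
move=> mg gh; apply: L1_dom => // x.
by have /andP[g0 ?] := gh x; rewrite ger0_norm.
Qed.

Lemma L1D g h : L1 g -> L1 h -> L1 (fun x => g x + h x).
Proof. by move=> ig ih; exact: (integrableD measurableT ig ih). Qed.

Lemma L1Z c g : L1 g -> L1 (fun x => c * g x).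
Proof. by move=> ig; exact: (integrableZl measurableT c ig). Qed.

Lemma L1N g : L1 g -> L1 (fun x => - g x).
Proof. by move=> ig; exact: (integrableN ig). Qed.

Lemma L1B g h : L1 g -> L1 h -> L1 (fun x => g x - h x).
Proof. by move=> ig ih; exact: (integrableB measurableT ig ih). Qed.

Lemma L1_cst c : L1 (cst c).
Proof. exact: finite_measure_integrable_cst. Qed.

Lemma Rintegral_cst_prob c : \int[P]_x c = c.
Proof.
rewrite Rintegral_cst//; have -> : fine (P setT) = 1 by rewrite
  probability_setT.
by rewrite mulr1.
Qed.

Lemma L1_sum (I : eqType) (r : seq I) (g : I -> T -> R) :
  (forall i, i \in r -> L1 (g i)) -> L1 (fun x => \sum_(i <- r) g i x).
Proof.
elim: r => [|i r IH] ig.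
  by under eq_fun do rewrite big_nil; exact: L1_cst.
under eq_fun do rewrite big_cons.
apply: L1D; first by apply: ig; rewrite inE eqxx.
by apply: IH => j jr; apply: ig; rewrite inE jr orbT.
Qed.

Lemma L1_max0 g : L1 g -> L1 (fun x => Num.max (g x) 0).
Proof.
move=> ig; apply: (@L1_ge0_dom _ (fun x => `|g x|)).
- exact: measurable_maxr (L1_measurable ig) (measurable_cst _).
- by move=> x; rewrite le_max lexx orbT ge_max normr_ge0 ler_norm.
- exact: (integrable_norm ig).
Qed.

Lemma EFin_Rintegral g : L1 g ->
  (\int[P]_x (g x)%:E = (\int[P]_x g x)%:E)%E.
Proof. by move=> ig; rewrite fineK//; exact: integrable_fin_num. Qed.

Lemma Rintegral_sum (I : eqType) (r : seq I) (g : I -> T -> R) :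
  (forall i, i \in r -> L1 (g i)) ->
  \int[P]_x (\sum_(i <- r) g i x) = \sum_(i <- r) \int[P]_x g i x.
Proof.
elim: r => [|i r IH] ig.
  under eq_Rintegral do rewrite big_nil.
  by rewrite Rintegral_cst_prob big_nil.
under eq_Rintegral do rewrite big_cons.
have igr j : j \in r -> L1 (g j) by move=> jr; apply: ig; rewrite inE jr orbT.
rewrite RintegralD//; last exact: L1_sum.
  by rewrite big_cons IH.
by apply: ig; rewrite inE eqxx.
Qed.

Lemma L1_of_finite g : measurable_fun setT g -> (forall x, 0 <= g x) ->
  (\int[P]_x (g x)%:E < +oo)%E -> L1 g.
Proof.
move=> mg g0 goo; apply/integrableP; split; first exact/measurable_EFinP.
by under eq_integral do rewrite /= ger0_norm//.
Qed.

End integrable_real.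

(** * Expectation of a filtered coordinate of either sign *)

Section unbiased_filter.
Context {R : realType} {n : nat} {d : measure_display} {X : measurableType d}.
Context {d' : measure_display} {Omega : measurableType d'}.
Context (P : probability Omega R) (Q : probability X R).
Context (f : 'rV[R]_n -> X -> R) (D : nat) (S : X -> seq {set 'I_n}).
Context (xi : nat -> {RV P >-> X}) (u : nat -> {RV P >-> nat}).
Context (Sigma : nat -> nat -> Omega -> {set 'I_n}).
Hypothesis fS : filter_family f D S.
Hypothesis freshP : fresh_sampling Q S xi u Sigma.

Lemma L1_sample t (b : X -> R) : L1 Q b -> (forall x, 0 <= b x) ->
  L1 P (b \o xi t) /\ \int[P]_o b (xi t o) = \int[Q]_x b x.
Proof.
move=> ib b0.
have mb := L1_measurable ib.
have E : (\int[P]_o (b (xi t o))%:E = \int[Q]_x (b x)%:E)%E.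
  apply: (ge0_integral_sample freshP t (h := EFin \o b)).
  - exact/measurable_EFinP.
  - by move=> x; rewrite lee_fin.
split; last by rewrite /Rintegral E.
apply: L1_of_finite => [|o|]; [exact: measurableT_comp|exact: b0|].
by rewrite E (EFin_Rintegral ib) ltry.
Qed.

Let coord t i (b : X -> R) o : R := (size (S (xi t o)))%:R * b (xi t o) *
  (i \in chosen_filter S xi u t o)%:R.

Lemma measurable_chosen_coord t i (b : X -> R) :
  measurable_fun setT b -> measurable_fun setT (coord t i b).
Proof.
move=> mb; apply: measurable_funM.
  apply: measurable_funM; last exact: measurableT_comp.
  exact: (measurableT_comp (measurable_filters fS (fun s => (size s)%:R : R))).
exact: (measurable_chosen xi u fS t (fun A => (i \in A)%:R : R)).
Qed.

Lemma L1_mem_Dxi i (b : X -> R) : L1 Q b ->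
  L1 Q (fun x => b x * (i \in Dxi f x)%:R).
Proof.
move=> ib; apply: (L1_dom (h := fun x => `|b x|)).
- by apply: measurable_funM; [exact: L1_measurable ib|exact: measurable_mem_Dxi
  fS i].
- by move=> x; case: (i \in _); rewrite ?mulr1 ?mulr0 ?normr0.
- exact: (integrable_norm ib).
Qed.

(** [coord] is linear in [b], so the identity for non-negative weights is applied to the positive
    and negative parts of [b], both integrable. *)
Lemma L1_chosen_coord t i (b : X -> R) : L1 Q b ->
  L1 P (coord t i b) /\
  \int[P]_o coord t i b o = \int[Q]_x (b x * (i \in Dxi f x)%:R).
Proof.
have pos c : L1 Q c -> (forall x, 0 <= c x) -> L1 P (coord t i c) /\
    \int[P]_o coord t i c o = \int[Q]_x (c x * (i \in Dxi f x)%:R).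
  move=> ic c0; have mc := L1_measurable ic.
  have E := ge0_integral_chosen fS freshP t i mc c0.
  split; last by rewrite /Rintegral E.
  apply: L1_of_finite => [|o|]; first exact: measurable_chosen_coord.
    by rewrite !mulr_ge0 ?ler0n.
  by rewrite E (EFin_Rintegral (L1_mem_Dxi i ic)) ltry.
move=> ib.
have [|p1 p2] := pos (fun x => Num.max (b x) 0) (L1_max0 ib).
  by move=> x; rewrite le_max lexx orbT.
have [|n1 n2] := pos (fun x => Num.max (- b x) 0) (L1_max0 (L1N ib)).
  by move=> x; rewrite le_max lexx orbT.
have cE : coord t i b = fun o => coord t i (fun x => Num.max (b x) 0) o -
    coord t i (fun x => Num.max (- b x) 0) o.
  by apply/funext => o; rewrite /coord -{1}(max0B (b (xi t o))) mulrBr mulrBl.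
split; first by rewrite cE; exact: L1B.
rewrite cE RintegralB// p2 n2 -RintegralB//.
- by apply: eq_Rintegral => x _; rewrite -mulrBl max0B.
- exact: L1_mem_Dxi (L1_max0 ib).
- exact: L1_mem_Dxi (L1_max0 (L1N ib)).
Qed.

End unbiased_filter.

(** * The filtered gradient, and its inner product with an independent vector *)

Section cross_term.
Context {R : realType} {n : nat} {d : measure_display} {X : measurableType d}.
Context {d' : measure_display} {Omega : measurableType d'}.
Context (P : probability Omega R) (Q : probability X R).
Context (f : 'rV[R]_n -> X -> R) (D : nat) (S : X -> seq {set 'I_n}).
Context (xi : nat -> {RV P >-> X}) (u : nat -> {RV P >-> nat}).
Context (Sigma : nat -> nat -> Omega -> {set 'I_n}).
Context (L mu : R) (wstar : 'rV[R]_n).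
Hypothesis fS : filter_family f D S.
Hypothesis freshP : fresh_sampling Q S xi u Sigma.
Hypothesis smf : forall x, smooth L (f^~ x).
Hypothesis unbf : unbiased_gradient Q f.

(** The update without its step size, at a free point [v]: it will be taken at [what t], [w t],
    [wstar] and at mesh points. *)
Definition filtered_grad t v o : 'rV[R]_n := (size (S (xi t o)))%:R *:
  (grad (f^~ (xi t o)) v *m diag01 (chosen_filter S xi u t o)).

Lemma measurable_grad v i : measurable_fun setT (fun x => grad (f^~ x) v 0 i).
Proof. by have [/(measurable_int Q)/measurable_EFinP] := unbf v i. Qed.

Lemma measurable_filtered_grad t V : measurable_vec V ->
  measurable_vec (fun o => filtered_grad t (V o) o).
Proof.
move=> mV; apply: (measurable_scaled_filter (z := xi t) (k := u t) fS) => //.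
exact: measurable_vec_grad smf measurable_grad mV _.
Qed.

Lemma filtered_gradE t v w o : vdot (filtered_grad t v o) w =
  \sum_(i < n) w 0 i * ((size (S (xi t o)))%:R * grad (f^~ (xi t o)) v 0 i *
                        (i \in chosen_filter S xi u t o)%:R).
Proof.
rewrite /filtered_grad vdotZl vdot_diag01 mulr_sumr.
by apply: eq_bigr => i _; ring.
Qed.

Lemma L1_filtered_grad t v w :
  L1 P (fun o => vdot (filtered_grad t v o) w) /\
  \int[P]_o vdot (filtered_grad t v o) w = vdot (grad (objective Q f) v) w.
Proof.
have ig i := L1_chosen_coord fS freshP t i (unbf v i).1.
have iw i : L1 P (fun o => w 0 i * ((size (S (xi t o)))%:R *
    grad (f^~ (xi t o)) v 0 i * (i \in chosen_filter S xi u t o)%:R)).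
  by apply: L1Z; exact: (ig i).1.
under eq_fun do rewrite filtered_gradE.
split; first by apply: L1_sum => i _; exact: iw.
rewrite Rintegral_sum; last by move=> i _; exact: iw.
apply: eq_bigr => i _; rewrite RintegralZl//; last exact: (ig i).1.
rewrite (ig i).2 mulrC; congr (_ * _).
have [_ ] := unbf v i; rewrite unlock => /(congr1 fine)/= <-.
apply: eq_Rintegral => x _; have [|] := boolP (i \in Dxi f x).
  by rewrite mulr1.
rewrite inE => /asboolPn; rewrite mulr0 => /forallNP/(_ v)/negP.
by rewrite negbK => /eqP ->.
Qed.

(** Valid for every outcome, hence also at points that depend on the sample. The price is the factor
    [D ^ 2] from [size (S x) <= D]. *)
Lemma nsq_filtered_grad_le t v w o :
  nsq (filtered_grad t v o - filtered_grad t w o) <=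
  D%:R ^+ 2 * L ^+ 2 * nsq (v - w).
Proof.
rewrite /filtered_grad -scalerBr -mulmxBl nsqZ -mulrA.
apply: ler_pM; rewrite ?sqr_ge0 ?nsq_ge0//.
  by rewrite lerXn2r ?nnegrE ?ler0n// ler_nat (size_filters_le fS).
exact: le_trans (nsq_diag01_le _ _) (smooth_sq _ _ (smf _)).
Qed.

Lemma nsq_filtered_grad_crude t v o :
  nsq (filtered_grad t v o) <= 2 * D%:R ^+ 2 * (L ^+ 2 * nsq (v - wstar) +
    nsq (grad (f^~ (xi t o)) wstar)).
Proof.
rewrite -[X in nsq X](subrK (filtered_grad t wstar o)).
apply: (le_trans (nsqD_le _ _)).
have vle := nsq_filtered_grad_le t v wstar o.
have : nsq (filtered_grad t wstar o) <=
    D%:R ^+ 2 * nsq (grad (f^~ (xi t o)) wstar).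
  rewrite /filtered_grad nsqZ.
  apply: ler_pM; rewrite ?sqr_ge0 ?nsq_ge0 ?nsq_diag01_le//.
  by rewrite lerXn2r ?nnegrE ?ler0n// ler_nat (size_filters_le fS).
by lra.
Qed.

Lemma independent_integral t A (h : X * nat -> \bar R) :
    history xi u Sigma t A -> measurable A ->
    measurable_fun setT h -> (forall y, 0 <= h y)%E ->
  (\int[P]_(o in A) h (xi t o, u t o) =
   P A * \int[P]_o h (xi t o, u t o))%E.
Proof.
move=> hA mA mh h0.
pose y o := (xi t o, u t o).
have my : measurable_fun setT y by exact: measurable_fun_pair.
have fin : P A \is a fin_num by exact: fin_num_measure.
rewrite -(fineK fin).
apply: (ge0_integral_transfer (z1 := y) (z2 := y) (A2 := setT)) => //.
  by rewrite fine_ge0.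
move=> B mB; rewrite setTI fineK//.
apply: (fresh freshP hA).
(* [Omega] is re-equipped with the sigma-algebra of the sample events, for which the pair of [xi t]
   and [u t] is measurable by construction; so preimages of measurable sets of the product are
   covered by [fresh]. *)
pose G := sample_events xi u t.
have mxi : measurable_fun setT (xi t : g_sigma_algebraType G -> X).
  by move=> _ C mC; apply: sub_sigma_algebra; left; exists C.
have mu' : measurable_fun setT (u t : g_sigma_algebraType G -> nat).
  by move=> _ C mC; apply: sub_sigma_algebra; right; exists C.
have := measurable_fun_pair mxi mu' measurableT mB.
by rewrite setTI.
Qed.

End cross_term.

Section cross_term_expectation.
Context {R : realType} {n : nat} {d : measure_display} {X : measurableType d}.
Context {d' : measure_display} {Omega : measurableType d'}.
Context (P : probability Omega R) (Q : probability X R).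
Context (f : 'rV[R]_n -> X -> R) (D : nat) (S : X -> seq {set 'I_n}).
Context (xi : nat -> {RV P >-> X}) (u : nat -> {RV P >-> nat}).
Context (Sigma : nat -> nat -> Omega -> {set 'I_n}).
Context (L mu : R) (wstar : 'rV[R]_n).
Hypothesis fS : filter_family f D S.
Hypothesis freshP : fresh_sampling Q S xi u Sigma.
Hypothesis smf : forall x, smooth L (f^~ x).
Hypothesis unbf : unbiased_gradient Q f.
Hypothesis mu_ge0 : 0 <= mu.
Hypothesis scF : strongly_convex mu (objective Q f).
Hypothesis minF : forall v, objective Q f wstar <= objective Q f v.
Hypothesis igrad : L1 Q (fun x => nsq (grad (f^~ x) wstar)).

Context (t : nat) (W : Omega -> 'rV[R]_n).
Hypothesis mW : measurable_vec W.
Hypothesis iW : L1 P (fun o => nsq (W o - wstar)).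

Let G v o := filtered_grad f S xi u t v o.

Let gs o := nsq (grad (f^~ (xi t o)) wstar).

Lemma L1_grad_wstar : L1 P gs.
Proof. by apply: (L1_sample freshP t igrad _).1 => x; exact: nsq_ge0. Qed.

Lemma L1_filtered_grad_comp V : measurable_vec V ->
    L1 P (fun o => nsq (V o - wstar)) ->
  L1 P (fun o => vdot (G (V o) o) (V o - wstar)).
Proof.
move=> mV iV.
have mVw : measurable_vec (fun o => V o - wstar).
  by apply: measurable_vecB => //; exact: measurable_vec_cst.
have mG := measurable_filtered_grad xi u fS smf unbf t mV.
apply: (L1_dom (h := fun o => 2 * D%:R ^+ 2 * (L ^+ 2 * nsq (V o - wstar) + gs
  o)
  + nsq (V o - wstar))).
- exact: measurable_vdot.
- move=> o; have G2 := nsq_filtered_grad_crude xi u wstar fS smf t (V o) o.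
  have := vdot_young (G (V o) o) (V o - wstar) (@ltr01 R).
  have := vdot_young (- G (V o) o) (V o - wstar) (@ltr01 R).
  rewrite vdotNl nsqN invr1 !mul1r ler_norml.
  have := nsq_ge0 (G (V o) o); have := nsq_ge0 (V o - wstar).
  by rewrite /gs; move: G2; rewrite -/(G (V o) o); lra.
- by apply: L1D => //; apply: L1Z; apply: L1D; [exact: L1Z|exact:
  L1_grad_wstar].
Qed.

Hypothesis hW : forall (h : R) q,
  history xi u Sigma t ((mesh_cell h \o W) @^-1` [set q]).

Let mesh (h : R) o := mesh_point h (mesh_cell h (W o)).

Lemma measurable_mesh h : measurable_vec (mesh h).
Proof.
move=> i; apply: (measurable_countable_comp (c := mesh_cell h \o W) (z := @id
  Omega)
  (F := fun q _ => mesh_point h q 0 i)) => [q||q].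
- exact: measurable_mesh_cell.
- exact: measurable_id.
- exact: measurable_cst.
Qed.

Lemma L1_mesh (h : R) : 0 < h -> L1 P (fun o => nsq (mesh h o - wstar)).
Proof.
move=> h0.
apply: (L1_ge0_dom (h := fun o => 2 * nsq (W o - wstar) + 2 * (n%:R * h ^+ 2))).
- apply: measurable_nsq; apply: measurable_vecB; first exact: measurable_mesh.
  exact: measurable_vec_cst.
- move=> o; rewrite nsq_ge0/= -[X in nsq X](subrKA (W o)) addrC.
  have := nsqD_le (W o - wstar) (mesh h o - W o).
  have := nsq_mesh_point (W o) h0; rewrite nsqBC -/(mesh h o).
  by lra.
- by apply: L1D; [exact: L1Z|exact: L1_cst].
Qed.

(** Strong convexity at a deterministic point. The negative part of the inner product is moved to
    the left, so that both integrands are non-negative, as the decomposition into cells and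
    [independent_integral] require. *)
Lemma cross_term_cell v :
  (\int[P]_o (Num.max (- vdot (G v o) (v - wstar)) 0 +
              mu / 2 * nsq (v - wstar))%:E <=
   \int[P]_o (Num.max (vdot (G v o) (v - wstar)) 0)%:E)%E.
Proof.
have [ig Eg] := L1_filtered_grad fS freshP unbf t v (v - wstar).
have ip := L1_max0 ig; have im := L1_max0 (L1N ig).
have im' : L1 P (fun o => Num.max (- vdot (G v o) (v - wstar)) 0 +
    mu / 2 * nsq (v - wstar)).
  by apply: L1D => //; exact: L1_cst.
rewrite (EFin_Rintegral ip) (EFin_Rintegral im') lee_fin RintegralD//; last
  first.
  exact: L1_cst.
rewrite Rintegral_cst_prob addrC -lerBrDr.
rewrite -RintegralB//; under eq_Rintegral do rewrite max0B.
by rewrite Eg strongly_convex_vdot.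
Qed.

(** On a cell the rounded vector is a constant [v] and the cell is an event of the history. By
    independence both sides of [cross_term_cell] at [v] are multiplied by the probability of the
    cell. *)
Lemma cross_term_mesh (h : R) : 0 < h ->
  mu / 2 * \int[P]_o nsq (mesh h o - wstar) <=
  \int[P]_o vdot (G (mesh h o) o) (mesh h o - wstar).
Proof.
move=> h0.
have iV := L1_mesh h0.
have ig := L1_filtered_grad_comp (measurable_mesh h) iV.
have ip := L1_max0 ig; have im := L1_max0 (L1N ig).
have iV' : L1 P (fun o => mu / 2 * nsq (mesh h o - wstar)) by exact: L1Z.
have im' := L1D im iV'.
suff : (\int[P]_o (Num.max (- vdot (G (mesh h o) o) (mesh h o - wstar)) 0 +
              mu / 2 * nsq (mesh h o - wstar))%:E <=
   \int[P]_o (Num.max (vdot (G (mesh h o) o) (mesh h o - wstar)) 0)%:E)%E.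
  rewrite (EFin_Rintegral ip) (EFin_Rintegral im') lee_fin RintegralD//.
  rewrite RintegralZl// addrC -lerBrDr -RintegralB//.
  by under [leRHS]eq_Rintegral do rewrite max0B.
have nn o : 0 <= mu / 2 * nsq (mesh h o - wstar).
  by rewrite mulr_ge0 ?nsq_ge0 ?divr_ge0.
(* [pickle] numbers the integer vectors; a number that codes no vector has an empty preimage. *)
apply: (ge0_le_integral_cells (c := pickle \o (mesh_cell h \o W))).
- move=> k; have [[q <-]|nok] := pselect (exists q : 'rV[int]_n, pickle q = k).
    rewrite (_ : _ @^-1` _ = (mesh_cell h \o W) @^-1` [set q]).
      exact: measurable_mesh_cell.
    apply/seteqP; split => o /=; last by move=> ->.
    exact: (pcan_inj pickleK).
  rewrite (_ : _ @^-1` _ = set0)//.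
  by rewrite -subset0 => o /= ok; apply: nok; exists (mesh_cell h (W o)).
- exact/measurable_EFinP/(L1_measurable im').
- by move=> o; rewrite lee_fin addr_ge0// le_max lexx orbT.
- exact/measurable_EFinP/(L1_measurable ip).
- by move=> o; rewrite lee_fin le_max lexx orbT.
move=> k; have [[q <-]|nok] := pselect (exists q : 'rV[int]_n, pickle q = k);
  last first.
  rewrite (_ : _ @^-1` _ = set0) ?integral_set0//.
  by rewrite -subset0 => o /= ok; apply: nok; exists (mesh_cell h (W o)).
rewrite (_ : _ @^-1` _ = (mesh_cell h \o W) @^-1` [set q]); last first.
  apply/seteqP; split => o /=; last by move=> ->.
  exact: (pcan_inj pickleK).
set A := _ @^-1` _; set v := mesh_point h q.
have mA : measurable A by exact: measurable_mesh_cell.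
pose g (y : X * nat) := vdot ((size (S y.1))%:R *:
  (grad (f^~ y.1) v *m diag01 (nth finset.set0 (S y.1) y.2))) (v - wstar).
have mg : measurable_fun setT g.
  apply: measurable_vdot; last exact: measurable_vec_cst.
  apply: (measurable_scaled_filter (z := fst) (k := snd) fS) => //.
  by apply: (measurable_vec_grad smf) => //; exact: measurable_grad unbf.
have gE o : g (xi t o, u t o) = vdot (G v o) (v - wstar) by [].
have vE o : A o -> mesh h o = v by move=> /= Ao; rewrite /mesh -/(v) /v -Ao.
have := cross_term_cell v => cell_le.
have mmax (c : X * nat -> R) : measurable_fun setT c ->
    measurable_fun setT (fun y : X * nat => Num.max (c y) 0).
  by move=> mc; exact: measurable_maxr mc (measurable_cst _).
rewrite [leLHS](_ : _ = \int[P]_(o in A)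
  (Num.max (- g (xi t o, u t o)) 0 + mu / 2 * nsq (v - wstar))%:E)%E; last
    first.
  by apply: eq_integral => o /set_mem/vE ->.
rewrite [leRHS](_ : _ = \int[P]_(o in A) (Num.max (g (xi t o, u t o)) 0)%:E)%E;
  last first.
  by apply: eq_integral => o /set_mem/vE ->.
rewrite (independent_integral freshP
  (h := fun y => (Num.max (- g y) 0 + mu / 2 * nsq (v - wstar))%:E))//; last 3
    first.
- exact: hW.
- apply/measurable_EFinP; apply: measurable_funD; last exact: measurable_cst.
  by apply: mmax; exact: measurableT_comp.
- move=> y; rewrite lee_fin addr_ge0 ?le_max ?lexx ?orbT//.
  by rewrite mulr_ge0 ?nsq_ge0 ?divr_ge0.
rewrite (independent_integral freshP (h := fun y => (Num.max (g y) 0)%:E))//;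
  last 3 first.
- exact: hW.
- by apply/measurable_EFinP; exact: mmax.
- by move=> y; rewrite lee_fin le_max lexx orbT.
by rewrite lee_wpmul2l.
Qed.

(** Young's inequality with weight [h]: the rounding error has square at most [n * h ^ 2], and
    [h^-1] times this is still of order [h]. *)
Lemma nsq_mesh_ge (h : R) o : 0 < h ->
  nsq (W o - wstar) - nsq (mesh h o - wstar) <= h * (nsq (W o - wstar) + n%:R).
Proof.
move=> h0; have := vdot_young (W o - wstar) (W o - mesh h o) h0.
have -> : mesh h o - wstar = (W o - wstar) + - (W o - mesh h o).
  by rewrite opprB [RHS]addrC subrKA.
have := nsq_mesh_point (W o) h0; rewrite -/(mesh h o).
rewrite (nsqD (W o - wstar)) vdotNr nsqN.
have := nsq_ge0 (W o - mesh h o).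
set x := nsq (W o - mesh h o) => x0 xh.
have : h^-1 * x <= n%:R * h by rewrite ler_pdivrMl// mulrCA -expr2.
by lra.
Qed.

(** The difference is split as [vdot (Gz - Gx) z + vdot Gx e]. Both [Gz - Gx] and [e] are of order
    [h], so each product is balanced by a Young weight [h^-1] or [h] that leaves a single factor
    [h]. *)
Lemma cross_mesh_le (h : R) o : 0 < h <= 1 ->
  vdot (G (mesh h o) o) (mesh h o - wstar) - vdot (G (W o) o) (W o - wstar) <=
  h * ((1 + D%:R ^+ 2 * L ^+ 2) * nsq (W o - wstar) + D%:R ^+ 2 * gs o +
       (D%:R ^+ 2 * L ^+ 2 + 3) * n%:R).
Proof.
move=> /andP[h0 h1].
have hV0 : 0 < h^-1 by rewrite invr_gt0.
set x := W o - wstar; set z := mesh h o - wstar; set e := mesh h o - W o.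
have zE : z = x + e by rewrite /z /x /e [RHS]addrC subrKA.
set Gz := G (mesh h o) o; set Gx := G (W o) o.
have -> : vdot Gz z - vdot Gx x = vdot (Gz - Gx) z + vdot Gx e.
  by rewrite zE vdotDl vdotNl (vdotDr Gx) opprD !addrA subrK.
have ele : nsq e <= n%:R * h ^+ 2.
  by rewrite /e nsqBC; exact: nsq_mesh_point.
have n0 : 0 <= n%:R :> R by [].
have enh : h^-1 * nsq e <= n%:R * h by rewrite ler_pdivrMl// mulrCA -expr2.
have en : nsq e <= n%:R.
  by apply: (le_trans ele); rewrite ler_piMr// exprn_ile1// ltW.
have Gze : h^-1 * nsq (Gz - Gx) <= D%:R ^+ 2 * L ^+ 2 * (n%:R * h).
  apply: (le_trans (ler_wpM2l (ltW hV0) (nsq_filtered_grad_le xi u fS smf t _ _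
    o))).
  by rewrite mulrCA ler_wpM2l// mulr_ge0 ?sqr_ge0.
have Gxle := nsq_filtered_grad_crude xi u wstar fS smf t (W o) o.
have hGx := ler_wpM2l (ltW h0) Gxle.
have zle : nsq z <= 2 * nsq x + 2 * n%:R.
  by rewrite zE; apply: (le_trans (nsqD_le _ _)); rewrite lerD2l ler_pM2l.
have hz := ler_wpM2l (ltW h0) zle.
have y1 := vdot_young (Gz - Gx) z hV0.
have y2 := vdot_young Gx e h0.
rewrite invrK in y1.
have nh0 : 0 <= n%:R * h by rewrite mulr_ge0// ltW.
have dnh0 : 0 <= D%:R ^+ 2 * L ^+ 2 * (n%:R * h).
  by rewrite mulr_ge0// mulr_ge0 ?sqr_ge0.
move: y1 y2 hz hGx Gze enh nh0 dnh0.
rewrite -/(G (W o) o) -/Gx -/x -/(gs o).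
move: (vdot _ z) (vdot _ e) (nsq z) (nsq x) (nsq Gx) (nsq e) (nsq (Gz - Gx)) (gs
  o).
by move=> *; lra.
Qed.

Lemma cross_term :
  mu / 2 * \int[P]_o nsq (W o - wstar) <=
  \int[P]_o vdot (G (W o) o) (W o - wstar).
Proof.
set x := \int[P]_o nsq (W o - wstar); set y := \int[P]_o vdot _ _.
have x0 : 0 <= x by apply: Rintegral_ge0 => o _; exact: nsq_ge0.
pose C := (1 + D%:R ^+ 2 * L ^+ 2) * x + D%:R ^+ 2 * \int[P]_o gs o +
  (D%:R ^+ 2 * L ^+ 2 + 3) * n%:R + mu / 2 * (x + n%:R).
have gs0 : 0 <= \int[P]_o gs o by apply: Rintegral_ge0 => o _; exact: nsq_ge0.
have D2 : 0 <= D%:R ^+ 2 :> R by exact: sqr_ge0.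
have L2 : 0 <= L ^+ 2 by exact: sqr_ge0.
have DL : 0 <= D%:R ^+ 2 * L ^+ 2 by exact: mulr_ge0.
have C0 : 0 <= C.
  apply: addr_ge0; last by rewrite mulr_ge0 ?divr_ge0// addr_ge0.
  apply: addr_ge0; last by rewrite mulr_ge0// addr_ge0.
  by rewrite addr_ge0// mulr_ge0// addr_ge0.
have le_h h : 0 < h <= 1 -> mu / 2 * x <= y + h * C.
  move=> h01; have /andP[h0 _] := h01.
  have iV := L1_mesh h0.
  have ig := L1_filtered_grad_comp (measurable_mesh h) iV.
  have igW := L1_filtered_grad_comp mW iW.
  have igs := L1_grad_wstar.
  have ic : L1 P (fun o => (1 + D%:R ^+ 2 * L ^+ 2) * nsq (W o - wstar) +
      D%:R ^+ 2 * gs o + (D%:R ^+ 2 * L ^+ 2 + 3) * n%:R).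
    by apply: L1D; [apply: L1D; exact: L1Z|exact: L1_cst].
  have := cross_term_mesh h0.
  set x' := \int[P]_o nsq (mesh h o - wstar).
  set y' := \int[P]_o vdot (G (mesh h o) o) (mesh h o - wstar).
  have : y' - y <= h * ((1 + D%:R ^+ 2 * L ^+ 2) * x + D%:R ^+ 2 * \int[P]_o gs
    o +
      (D%:R ^+ 2 * L ^+ 2 + 3) * n%:R).
    rewrite /y' /y -RintegralB//.
    apply: (le_trans (le_Rintegral measurableT (L1B ig igW) (L1Z h ic)
      (fun o _ => cross_mesh_le o h01))).
    rewrite RintegralZl//; have ix1 := L1Z (1 + D%:R ^+ 2 * L ^+ 2) iW.
    have igs1 := L1Z (D%:R ^+ 2) igs.
    rewrite (RintegralD measurableT (L1D ix1 igs1) (L1_cst _ _)).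
    by rewrite (RintegralD measurableT ix1 igs1)/= Rintegral_cst_prob
      !RintegralZl.
  have : x - x' <= h * (x + n%:R).
    rewrite /x /x' -RintegralB//.
    have ixn : L1 P (fun o => nsq (W o - wstar) + n%:R).
      by apply: L1D => //; exact: L1_cst.
    apply: (le_trans (le_Rintegral measurableT (L1B iW iV) (L1Z h ixn)
      (fun o _ => nsq_mesh_ge o h0))).
    rewrite RintegralZl// RintegralD ?Rintegral_cst_prob//; exact: L1_cst.
  rewrite /C => xx yy xy.
  have := ler_wpM2l mu_ge0 xx; lra.
apply/ler_addgt0Pr => e e0.
have C1 : 0 < C + 1 by rewrite ltr_wpDl.
(* This width makes [h * C <= e]; [C + 1] serves as denominator because [C] may be zero. *)
have /le_h : 0 < Num.min 1 (e / (C + 1)) <= 1.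
  by rewrite lt_min ltr01 divr_gt0//= ge_min lexx.
move=> /le_trans; apply; rewrite lerD2l.
apply: (@le_trans _ _ (e / (C + 1) * C)).
  by rewrite ler_wpM2r// ge_min lexx orbT.
by rewrite mulrAC ler_pdivrMr// ler_pM2l// lerDl.
Qed.

End cross_term_expectation.

(** * Deterministic analysis of the delayed recursion *)

Section delayed_recursion.
Context {R : realType}.
Context (mu alpha E A c1 c2 k1 k2 : R) (tau : nat) (al : nat -> R).
Context (x xhat delta : nat -> R).
Let y (t : nat) : R := t%:R + E.
Let eta t := al t / (mu * y t).
Hypothesis mu_gt0 : 0 < mu.
Hypothesis E_gt0 : 0 < E.
Hypothesis al_bounds : forall t, 4 <= al t <= alpha.
Hypothesis tau_le : 2 * tau%:R <= E.
Hypothesis A_ge0 : 0 <= A.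
Hypothesis c1_ge0 : 0 <= c1.
Hypothesis c2_ge0 : 0 <= c2.
Hypothesis k1_ge0 : 0 <= k1.
Hypothesis k2_ge0 : 0 <= k2.
Hypothesis x_ge0 : forall t, 0 <= x t.
Hypothesis xhat_ge0 : forall t, 0 <= xhat t.
Hypothesis x_step : forall t, x t.+1 <= (1 - 3 / 4 * mu * eta t) * x t +
  eta t * c1 * delta t + eta t ^+ 2 * (A + c2 * xhat t).
Hypothesis delta_le : forall t,
  delta t <= \sum_(t - tau <= j < t) eta j ^+ 2 * (k1 + k2 * xhat j).
Hypothesis xhat_le : forall t, xhat t <= 2 * x t + 2 * delta t.

Let e t := alpha / (mu * y t).

Let y_gt0 t : 0 < y t.
Proof. by rewrite /y ltr_wpDl. Qed.

Let alpha_gt0 : 0 < alpha.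
Proof. by have /andP[] := al_bounds 0; lra. Qed.

Let e_gt0 t : 0 < e t.
Proof. by rewrite divr_gt0// mulr_gt0. Qed.

Let eta_gt0 t : 0 < eta t.
Proof. by rewrite divr_gt0 ?mulr_gt0//; have /andP[] := al_bounds t; lra. Qed.

Let eta_le t : eta t <= e t.
Proof.
rewrite ler_wpM2r ?invr_ge0 ?(ltW (mulr_gt0 _ _))//.
by have /andP[] := al_bounds t.
Qed.

Let mu_eta_ge t : 4 / y t <= mu * eta t.
Proof.
have -> : mu * eta t = al t / y t.
  by rewrite /eta; field; rewrite !gt_eqF.
rewrite ler_wpM2r ?invr_ge0 ?(ltW (y_gt0 t))//.
by have /andP[] := al_bounds t.
Qed.

(** This is where [E >= 2 * tau] enters: within the window [y j >= y t / 2], so step sizes exceed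
    [e t] at most by a factor 2. *)
Let eta_window_le t j : (t - tau <= j < t)%N -> eta j <= 2 * e t.
Proof.
move=> /andP[tj jt]; apply: (le_trans (eta_le j)).
rewrite /e mulrCA ler_wpM2l ?(ltW alpha_gt0)//.
rewrite -[2]invrK -invfM lef_pV2 ?posrE ?mulr_gt0 ?invr_gt0// mulrCA ler_pM2l//.
rewrite ler_pdivrMl// /y.
have : (t%:R : R) <= j%:R + tau%:R by rewrite -natrD ler_nat addnC -leq_subLR.
have : (0 : R) <= j%:R by [].
have := tau_le; have := E_gt0; lra.
Qed.

Let delta_window_le t M : 0 <= M -> (forall j, (j < t)%N -> xhat j <= M) ->
  delta t <= 4 * tau%:R * e t ^+ 2 * (k1 + k2 * M).
Proof.
move=> M0 xM; apply: (le_trans (delta_le t)).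
have kM0 : 0 <= k1 + k2 * M by rewrite addr_ge0// mulr_ge0.
apply: (@le_trans _ _ (\sum_(t - tau <= j < t) 4 * e t ^+ 2 * (k1 + k2 * M))).
  apply: ler_sum_nat => j tj; have /andP[_ jt] := tj.
  apply: ler_pM; rewrite ?sqr_ge0 ?addr_ge0 ?mulr_ge0//; last first.
    by rewrite lerD2l ler_wpM2l// xM.
  have -> : 4 * e t ^+ 2 = (2 * e t) ^+ 2 by ring.
  rewrite lerXn2r ?nnegrE ?(ltW (eta_gt0 _))//; last exact: eta_window_le.
  by rewrite mulr_ge0// ltW.
rewrite sumr_const_nat -[leLHS]mulr_natr.
have : ((t - (t - tau))%:R : R) <= tau%:R by rewrite ler_nat leq_subCl.
have : 0 <= 4 * e t ^+ 2 * (k1 + k2 * M).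
  by rewrite mulr_ge0// mulr_ge0// sqr_ge0.
set z := 4 * e t ^+ 2 * (k1 + k2 * M); move=> z0 tt.
have -> : 4 * tau%:R * e t ^+ 2 * (k1 + k2 * M) = z * tau%:R by rewrite /z;
  ring.
by rewrite ler_wpM2l.
Qed.

Let e_small (b : R) : 0 < b -> exists T, forall t, (T <= t)%N -> e t <= b.
Proof.
move=> b0; exists (Num.bound (alpha / (mu * b))) => t Tt.
rewrite /e ler_pdivrMr ?mulr_gt0// mulrA -ler_pdivrMl ?mulr_gt0// mulrC [b *
  mu]mulrC.
apply: (@le_trans _ _ t%:R); last by rewrite /y lerDl ltW.
apply: (@le_trans _ _ (Num.bound (alpha / (mu * b)))%:R); last by rewrite
  ler_nat.
apply: ltW; apply: archi_boundP.
by rewrite divr_ge0 ?(ltW alpha_gt0) ?(ltW (mulr_gt0 _ _)).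
Qed.

(** Induction from a time [T] after which the steps are small, with the invariant [4 * x t <= M] and
    [xhat j <= M] for [j <= t]. The factor 4 leaves [M / 2] for each of the two summands in
    [xhat t <= 2 * x t + 2 * delta t]. *)
Lemma xhat_bounded : exists2 M, 0 <= M & forall t, xhat t <= M.
Proof.
pose C := 4 * tau%:R * (c1 + 2) * (k1 + k2) + A + c2 + mu + 1.
have C_gt0 : 0 < C.
  by rewrite ltr_wpDl// !addr_ge0 ?mulr_ge0 ?addr_ge0// ltW.
(* [3 / 16 * mu] is the contraction [3 / 4 * mu] acting on the level [M / 4], which therefore
   absorbs noise and delay. The bound [2^-1] keeps [2 * delta] below [M / 2], and [mu * eta] below
   [2^-1]. *)
pose b := Num.min 1 (Num.min (3 / 16 * mu / C) (2^-1 / C)).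
have b_gt0 : 0 < b by rewrite !lt_min ltr01 !divr_gt0 ?mulr_gt0.
have [T eT] := e_small b_gt0.
have eP t : (T <= t)%N -> [/\ e t <= 1, e t * C <= 3 / 16 * mu & e t * C <=
  2^-1].
  move=> /eT; rewrite !le_min => /and3P[e1 e2 e3].
  by split=> //; rewrite -ler_pdivlMr.
(* The sum covers all times up to [T], where the steps need not be small; the summand 1 allows the
   constants [A] and [k1] to be bounded by [A * M] and [k1 * M]. *)
pose M := 1 + \sum_(j < T.+1) (4 * x j + xhat j).
have M1 : 1 <= M.
  by rewrite lerDl sumr_ge0// => j _; rewrite addr_ge0// mulr_ge0.
have init j : (j <= T)%N -> 4 * x j + xhat j <= M.
  move=> jT; rewrite /M (bigD1 (Ordinal (jT : (j < T.+1)%N)))//=.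
  rewrite addrCA lerDl addr_ge0// sumr_ge0// => i _.
  by rewrite addr_ge0// mulr_ge0.
have dM t : (T <= t)%N -> (forall j, (j < t)%N -> xhat j <= M) ->
    delta t <= e t * (4 * tau%:R * (k1 + k2)) * M.
  move=> Tt xM; have [e1 _ _] := eP t Tt; have e0 := ltW (e_gt0 t).
  apply: (le_trans (delta_window_le (le_trans ler01 M1) xM)).
  have -> : 4 * tau%:R * e t ^+ 2 * (k1 + k2 * M) =
    e t * (4 * tau%:R) * (e t * (k1 + k2 * M)) by ring.
  have -> : e t * (4 * tau%:R * (k1 + k2)) * M =
    e t * (4 * tau%:R) * ((k1 + k2) * M) by ring.
  have tau0 : 0 <= 4 * tau%:R :> R by rewrite mulr_ge0.
  apply: ler_wpM2l; first exact: mulr_ge0.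
  apply: (@le_trans _ _ (1 * (k1 + k2 * M))).
    by rewrite ler_wpM2r// addr_ge0// mulr_ge0// (le_trans ler01).
  by rewrite mul1r mulrDl lerD2r ler_peMr.
have tk0 : 0 <= 4 * tau%:R * (k1 + k2) by rewrite !mulr_ge0// addr_ge0.
suff key t : (T <= t)%N -> 4 * x t <= M /\ forall j, (j <= t)%N -> xhat j <= M.
  exists M => [|t]; first exact: le_trans M1.
  have [tT|/ltnW Tt] := leqP t T; last by have [_] := key t Tt; exact.
  by apply: le_trans (init t tT); rewrite lerDr mulr_ge0.
elim: t => [|t IH].
  rewrite leqn0 => /eqP T0; split=> [|j].
    by apply: le_trans (init 0%N _); rewrite ?T0// lerDl.
  rewrite leqn0 => /eqP ->.
  by apply: le_trans (init 0%N _); rewrite ?T0// lerDr mulr_ge0.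
rewrite leq_eqVlt => /predU1P[<-|Tt].
  split=> [|j jT].
    by apply: le_trans (init T _) => //; rewrite lerDl.
  by apply: le_trans (init j jT); rewrite lerDr mulr_ge0.
rewrite ltnS in Tt; have [xM xhM] := IH Tt.
have dt : delta t <= e t * (4 * tau%:R * (k1 + k2)) * M.
  by apply: dM => // j /ltnW; exact: xhM.
have dt1 : delta t.+1 <= e t.+1 * (4 * tau%:R * (k1 + k2)) * M.
  by apply: dM => [|j]; [exact: leqW|rewrite ltnS; exact: xhM].
have M0 : 0 <= M by exact: le_trans M1.
set K := 4 * tau%:R * (k1 + k2) in tk0 dt dt1.
have CE : C = K * c1 + 2 * K + A + c2 + mu + 1 by rewrite /C /K; ring.
clearbody K C M.
have [A0 c20 c10 mu0] : [/\ 0 <= A, 0 <= c2, 0 <= c1 & 0 < mu] by split.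
have Kc1 : 0 <= K * c1 by exact: mulr_ge0.
have xS : 4 * x t.+1 <= M.
  have [e1 eC eC2] := eP t Tt.
  have n0 := eta_gt0 t; have ne := eta_le t; have e0 := e_gt0 t.
  have xh := xhM t (leqnn _); have xh0 := xhat_ge0 t; have x0 := x_ge0 t.
  have mun : mu * eta t <= 2^-1.
    apply: le_trans eC2; rewrite mulrC; apply: ler_pM => //; try exact: ltW.
    by rewrite CE; lra.
  have r1 : (1 - 3 / 4 * mu * eta t) * x t <= (1 - 3 / 4 * mu * eta t) * (M /
    4).
    by apply: ler_wpM2l; lra.
  have r2 : eta t * c1 * delta t <= eta t * (M * (e t * (K * c1))).
    rewrite -mulrA; apply: ler_wpM2l; first exact: ltW.
    have -> : M * (e t * (K * c1)) = c1 * (e t * K * M) by ring.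
    exact: ler_wpM2l.
  have r3 : eta t ^+ 2 * (A + c2 * xhat t) <= eta t * (M * (e t * (A + c2))).
    rewrite expr2 -mulrA; apply: ler_wpM2l; first exact: ltW.
    have -> : M * (e t * (A + c2)) = e t * (M * A + M * c2) by ring.
    apply: ler_pM => //; first exact: ltW.
      by apply: addr_ge0 => //; exact: mulr_ge0.
    by apply: lerD; [exact: ler_peMl|rewrite mulrC ler_wpM2r].
  have r4 : eta t * (M * (e t * (K * c1))) + eta t * (M * (e t * (A + c2))) <=
      eta t * (M * (3 / 16 * mu)).
    rewrite -mulrDr -mulrDr -mulrDr; apply: ler_wpM2l; first exact: ltW.
    apply: ler_wpM2l => //; apply: le_trans eC; apply: ler_wpM2l; first exact:
      ltW.
    by rewrite CE; lra.
  by have := x_step t; move: (eta t * c1 * _) (eta t ^+ 2 * _) r1 r2 r3 r4 => *;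
    lra.
split=> // j; rewrite leq_eqVlt => /predU1P[->|]; last by rewrite ltnS; exact:
  xhM.
have [e1 _ eC2] := eP t.+1 (leqW Tt).
have : e t.+1 * K * M * 2 <= 2^-1 * M.
  rewrite mulrAC; apply: ler_wpM2r => //; apply: le_trans eC2.
  rewrite -mulrA; apply: ler_wpM2l; first exact/ltW/e_gt0.
  by rewrite CE; lra.
by have := xhat_le t.+1; lra.
Qed.

Lemma delta_decay : exists2 K, 0 <= K & forall t, delta t <= K / y t ^+ 2.
Proof.
have [M M0 xM] := xhat_bounded.
exists (4 * tau%:R * (alpha / mu) ^+ 2 * (k1 + k2 * M)).
  apply: mulr_ge0; last by apply: addr_ge0 => //; exact: mulr_ge0.
  by apply: mulr_ge0; [exact: mulr_ge0|exact: sqr_ge0].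
move=> t; apply: (le_trans (delta_window_le M0 (fun j _ => xM j))).
rewrite le_eqVlt; apply/orP; left; apply/eqP; rewrite /e; field.
by rewrite !gt_eqF.
Qed.

(* [(1 - 2 / y) y ^ 2 <= (y - 1) ^ 2] with [y = t + E], so that
   [x t * (t + E - 1) ^ 2] grows at each step by the constant noise term and by
   the delay contribution, which is of order [1 / y]. *)
Lemma weighted_growth : exists2 K, 0 <= K &
  exists T, forall t, (T <= t)%N ->
    x t.+1 * (y t.+1 - 1) ^+ 2 <=
    x t * (y t - 1) ^+ 2 + A * (alpha / mu) ^+ 2 + K / y t.
Proof.
have [K K0 dK] := delta_decay.
have am0 : 0 <= alpha / mu by rewrite divr_ge0 ?(ltW alpha_gt0) ?(ltW mu_gt0).
exists (alpha / mu * c1 * K + (alpha / mu) ^+ 2 * (2 * c2 * K) / E).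
  apply: addr_ge0; first by apply: mulr_ge0 => //; exact: mulr_ge0.
  apply: divr_ge0; last exact: ltW.
  by apply: mulr_ge0; [exact: sqr_ge0|apply: mulr_ge0 => //; exact: mulr_ge0].
(* Below this step size the part [2 * c2 * eta ^ 2 * x] of the noise costs at most
   [mu * eta / 4 * x]. *)
have b0 : 0 < mu / (8 * (c2 + 1)) by rewrite divr_gt0// mulr_gt0// ltr_wpDl.
have [T eT] := e_small b0; exists T => t Tt.
have -> : y t.+1 - 1 = y t by rewrite /y -natr1; ring.
have y0 := y_gt0 t; have yE : E <= y t by rewrite /y lerDr.
have n0 := eta_gt0 t; have ne := eta_le t; have e0 := e_gt0 t.
have eE : e t * y t = alpha / mu by rewrite /e; field; rewrite !gt_eqF.
have ny : eta t * y t <= alpha / mu by rewrite -eE ler_wpM2r// ltW.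
have mny : 4 <= mu * eta t * y t.
  by rewrite -ler_pdivrMr//; exact: mu_eta_ge.
have nc : eta t * (8 * c2) <= mu.
  apply: (@le_trans _ _ (eta t * (8 * (c2 + 1)))).
    by apply: ler_wpM2l; [exact: ltW|lra].
  rewrite -ler_pdivlMr; last by rewrite mulr_gt0// ltr_wpDl.
  exact: le_trans (eT t Tt).
have x0 := x_ge0 t.
have ddK : delta t * y t ^+ 2 <= K by rewrite -ler_pdivlMr ?exprn_gt0.
have xS : x t.+1 <= (1 - 3 / 4 * mu * eta t) * x t + eta t * c1 * delta t +
    eta t ^+ 2 * (A + c2 * (2 * x t + 2 * delta t)).
  apply: (le_trans (x_step t)); rewrite lerD2l; apply: ler_wpM2l.
    exact: sqr_ge0.
  by rewrite lerD2l; apply: ler_wpM2l.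
have [A0 c20 c10 mu0] : [/\ 0 <= A, 0 <= c2, 0 <= c1 & 0 < mu] by split.
move: (y t) (eta t) (x t) (delta t) y0 yE n0 ny mny nc x0 ddK xS
  => yy m z dd y0 yE m0 my mmy mc z0 ddK xS.
have y2 : 0 <= yy ^+ 2 by exact: sqr_ge0.
apply: (le_trans (ler_wpM2r y2 xS)).
have -> : ((1 - 3 / 4 * mu * m) * z + m * c1 * dd +
    m ^+ 2 * (A + c2 * (2 * z + 2 * dd))) * yy ^+ 2 =
  z * (yy ^+ 2 - 3 / 4 * (mu * m * yy) * yy + m * (2 * c2) * (m * yy) * yy) +
  A * (m * yy) ^+ 2 + (m * c1 * (dd * yy ^+ 2) +
  m ^+ 2 * (2 * c2 * (dd * yy ^+ 2))) by ring.
(* Of the contraction rate [3 / 4], a quarter pays for the noise. The remaining half of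
   [mu * m * yy >= 4] leaves at most [yy ^ 2 - 2 * yy]. *)
have ha : z * (yy ^+ 2 - 3 / 4 * (mu * m * yy) * yy + m * (2 * c2) * (m * yy) *
  yy)
    <= z * (yy - 1) ^+ 2.
  apply: ler_wpM2l => //.
  have : m * (2 * c2) * (m * yy) * yy <= mu / 4 * (m * yy) * yy.
    apply: ler_wpM2r; first exact: ltW.
    by apply: ler_wpM2r; [apply: mulr_ge0; exact: ltW|lra].
  have := ler_wpM2r (ltW y0) mmy; have := sqr_ge0 (yy - 1).
  by lra.
have hc : A * (m * yy) ^+ 2 <= A * (alpha / mu) ^+ 2.
  apply: ler_wpM2l => //; rewrite lerXn2r// ?nnegrE//.
  by apply: mulr_ge0; exact: ltW.
have mE : m <= alpha / mu / yy by rewrite ler_pdivlMr.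
have hb : m * c1 * (dd * yy ^+ 2) <= alpha / mu / yy * c1 * K.
  apply: (@le_trans _ _ (m * c1 * K)).
    by apply: ler_wpM2l => //; apply: mulr_ge0 => //; exact: ltW.
  by apply: ler_wpM2r => //; apply: ler_wpM2r.
have hd : m ^+ 2 * (2 * c2 * (dd * yy ^+ 2)) <=
    (alpha / mu) ^+ 2 / E / yy * (2 * c2 * K).
  apply: (@le_trans _ _ (m ^+ 2 * (2 * c2 * K))).
    apply: ler_wpM2l; first exact: sqr_ge0.
    by apply: ler_wpM2l => //; exact: mulr_ge0.
  apply: ler_wpM2r; first by apply: mulr_ge0 => //; exact: mulr_ge0.
  apply: (@le_trans _ _ ((alpha / mu / yy) ^+ 2)).
    by rewrite lerXn2r// ?nnegrE; [exact: ltW|apply: divr_ge0 => //; exact: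
      ltW].
  have -> : (alpha / mu / yy) ^+ 2 = (alpha / mu) ^+ 2 * (yy^-1 * yy^-1) by
    ring.
  rewrite -mulrA; apply: ler_wpM2l; first exact: sqr_ge0.
  by apply: ler_wpM2r; [rewrite invr_ge0 ltW|rewrite lef_pV2 ?posrE].
have -> : (alpha / mu * c1 * K + (alpha / mu) ^+ 2 * (2 * c2 * K) / E) / yy =
  alpha / mu / yy * c1 * K + (alpha / mu) ^+ 2 / E / yy * (2 * c2 * K) by ring.
by apply: lerD; exact: lerD.
Qed.

(** The growth estimate is summed, and the harmonic sum of the delay terms is telescoped against
    increments of [ln]. *)
Lemma weighted_bound : exists B K, forall t, (0 < t)%N ->
  x t * (y t - 1) ^+ 2 <= B + t%:R * (A * (alpha / mu) ^+ 2) + K * ln t%:R.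
Proof.
have [K K0 [T xT]] := weighted_growth.
have q0 : 0 <= A * (alpha / mu) ^+ 2 by apply: mulr_ge0 => //; exact: sqr_ge0.
set q := A * (alpha / mu) ^+ 2 in xT q0 *.
(* [B] alone dominates every time up to [T + 1], before the growth estimate takes over. *)
pose B := \sum_(j < T.+2) x j * (y j - 1) ^+ 2.
have p0 j : 0 <= x j * (y j - 1) ^+ 2 by apply: mulr_ge0 => //; exact: sqr_ge0.
(* This is [ln (1 + z) <= z] at [z = - 1 / (t + 1)]. *)
have lnS t : (0 < t)%N -> (t%:R + 1)^-1 <= ln (t%:R + 1) - ln t%:R :> R.
  move=> t0; have t0R : 0 < t%:R :> R by rewrite ltr0n.
  have t1 : 0 < t%:R + 1 :> R by exact: addr_gt0.
  have tV : (t%:R + 1)^-1 < 1 :> R by rewrite invf_lt1// ltrDr.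
  have := @le_ln1Dx R (- (t%:R + 1)^-1); rewrite ltrN2 tV => /(_ isT).
  have -> : 1 - (t%:R + 1)^-1 = t%:R / (t%:R + 1) :> R.
    by field; rewrite gt_eqF.
  by rewrite ln_div ?posrE//; lra.
(* The factor 2 comes from [1 / y t <= 1 / t <= 2 / (t + 1)]. *)
exists B, (2 * K); elim=> // t IH _.
have ln0 m : (0 < m)%N -> 0 <= ln m%:R :> R by move=> m0; rewrite ln_ge0//
  ler1n.
have [tT|Tt] := leqP t T.
  apply: (@le_trans _ _ B).
    rewrite /B (bigD1 (Ordinal (tT : (t.+1 < T.+2)%N)))//= lerDl.
    by apply: sumr_ge0.
  by rewrite -addrA lerDl addr_ge0// mulr_ge0// ?ln0// mulr_ge0.
have t0 : (0 < t)%N by exact: leq_trans Tt.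
have t0R : 0 < t%:R :> R by rewrite ltr0n.
apply: (le_trans (xT t (ltnW Tt))).
have Ky : K / y t <= 2 * K * (ln (t%:R + 1) - ln t%:R).
  apply: (@le_trans _ _ (K * (2 * (t%:R + 1)^-1))).
    apply: ler_wpM2l => //.
    apply: (@le_trans _ _ t%:R^-1).
      by rewrite lef_pV2 ?posrE// /y lerDl ltW.
    rewrite -[leLHS]mul1r ler_pdivrMr// mulrAC ler_pdivlMr ?addr_gt0// mul1r.
    have : 1 <= t%:R :> R by rewrite ler1n.
    by lra.
  rewrite mulrA [K * 2]mulrC; apply: ler_wpM2l; last exact: lnS.
  exact: mulr_ge0.
have := IH t0; rewrite -[t.+1%:R]natr1; move: Ky.
by move: (ln _) (ln _) (K / y t) (x t * _) => *; lra.
Qed.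

End delayed_recursion.

(* The expansion of [|x - eta g| ^ 2], with [y = vdot g x], [yw = vdot gw x],
   [zd], [zx], [zg], [z0] and [zh] the squared norms of [what - w], [x], [g],
   the filtered gradient at [wstar] and [what - wstar]. *)
Lemma step_arith (R : realFieldType) (eta mu c y yw zd zx zg z0 zh : R) :
    0 <= eta ->
    2 * (yw - y) <= 4 / mu * (c * zd) + mu / 4 * zx ->
    zg <= 2 * (c * zh) + 2 * z0 ->
  eta ^+ 2 * zg + 2 * - (eta * y) + zx <=
  (1 + eta * (mu / 4)) * zx - 2 * eta * yw +
  (eta * (4 / mu * c) * zd + eta ^+ 2 * (2 * z0 + 2 * c * zh)).
Proof.
move=> eta0 /(ler_wpM2l eta0) h1 /(ler_wpM2l (sqr_ge0 eta)) h2.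
move: (4 / mu) (mu / 4) h1 h2 => k j h1 h2; lra.
Qed.

(** Origin of the rate [3 / 4]: strong convexity turns [- 2 * eta * y] into [- mu * eta * x], and a
    quarter of this was spent on moving from [w] to [what]. *)
Lemma moment_arith (R : realFieldType) (eta mu c1 c2 x x1 y dd z s h : R) :
    eta * (mu / 2 * x) <= eta * y -> eta ^+ 2 * z <= eta ^+ 2 * s ->
    x1 <= (1 + eta * (mu / 4)) * x - 2 * eta * y +
      (eta * c1 * dd + eta ^+ 2 * (2 * z + 2 * c2 * h)) ->
  x1 <= (1 - 3 / 4 * mu * eta) * x + eta * c1 * dd +
    eta ^+ 2 * (2 * s + 2 * c2 * h).
Proof. lra. Qed.

(** * Moments of the iterates and the one-step recursion *)

Section one_step.
Context {R : realType} {n : nat} {d : measure_display} {X : measurableType d}.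
Context {d' : measure_display} {Omega : measurableType d'}.
Context (P : probability Omega R) (Q : probability X R).
Context (f : 'rV[R]_n -> X -> R) (D : nat) (S : X -> seq {set 'I_n}).
Context (xi : nat -> {RV P >-> X}) (u : nat -> {RV P >-> nat}).
Context (Sigma : nat -> nat -> Omega -> {set 'I_n}).
Context (L mu : R) (tau : nat) (eta : nat -> R) (w0 wstar : 'rV[R]_n).
Context (w what : nat -> Omega -> 'rV[R]_n).
Hypothesis fS : filter_family f D S.
Hypothesis freshP : fresh_sampling Q S xi u Sigma.
Hypothesis smf : forall x, smooth L (f^~ x).
Hypothesis unbf : unbiased_gradient Q f.
Hypothesis mu_gt0 : 0 < mu.
Hypothesis scF : strongly_convex mu (objective Q f).
Hypothesis minF : forall v, objective Q f wstar <= objective Q f v.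
Hypothesis igrad : L1 Q (fun x => nsq (grad (f^~ x) wstar)).
Hypothesis wE : hogwild_recursion f S xi u eta w0 w what.
Hypothesis whatE : consistent_with_delay f S xi u Sigma tau eta w what.

Let upd := update f S xi u eta what.
Let G t v o := filtered_grad f S xi u t v o.
Let gs t o := nsq (grad (f^~ (xi t o)) wstar).

Let updE t o : upd t o = eta t *: G t (what t o) o.
Proof. by rewrite /upd /update /G /filtered_grad scalerA. Qed.

Let measurable_iterate t :
  measurable_vec (w t) /\ measurable_vec (what t).
Proof.
have mxi s : (s < t.+1)%N -> measurable_fun setT (xi s) by [].
have mu' s : (s < t.+1)%N -> measurable_fun setT (u s) by [].
have mSigma s j B : (s < t.+1)%N -> measurable (Sigma s j @^-1` B).
  by move=> _; exact: measurable_read freshP s j B.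
have [mw mwhat] := measurable_iterates fS smf (measurable_grad unbf)
  (fun s o => erefl (upd s o)) wE whatE mxi mu' mSigma t.
by split; [exact: mw|exact: mwhat].
Qed.

(** [measurable_iterates] is read over [Omega] equipped with the sigma-algebra of the history, where
    measurability of a cell means that it is an event of the history. *)
Let history_iterate t (h : R) q :
  history xi u Sigma t ((mesh_cell h \o w t) @^-1` [set q]).
Proof.
pose H := \bigcup_(s in `I_t) (sample_events xi u s `|`
  \bigcup_(j in setT) preimage_set_system setT (Sigma s j) setT).
have inH s A : (s < t)%N -> sample_events xi u s A -> <<s H >> A.
  by move=> st sA; apply: sub_sigma_algebra; exists s => //; left.
pose T := g_sigma_algebraType H.
have mxi s : (s < t)%N -> measurable_fun setT (xi s : T -> X).
  by move=> st _ B mB; apply: (inH s) => //; left; exists B.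
have mu' s : (s < t)%N -> measurable_fun setT (u s : T -> nat).
  by move=> st _ B mB; apply: (inH s) => //; right; exists B.
have mSigma s j B : (s < t)%N -> measurable (Sigma s j @^-1` B : set T).
  move=> st; apply: sub_sigma_algebra; exists s => //; right.
  by exists j => //; exists B => //; rewrite setTI.
have [mw _] := measurable_iterates (T := T) fS smf (measurable_grad unbf)
  (fun s o => erefl (upd s o)) wE whatE mxi mu' mSigma t.
exact: (measurable_mesh_cell (T := T) h q (mw (leqnn t))).
Qed.

Let L1_gs t : L1 P (gs t) /\ \int[P]_o gs t o =
  \int[Q]_x nsq (grad (f^~ x) wstar).
Proof. by apply: (L1_sample freshP t igrad) => x; exact: nsq_ge0. Qed.

Let w_window t k : (k <= t)%N ->
  forall o, w t o = w (t - k)%N o - \sum_(t - k <= j < t) upd j o.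
Proof.
elim: t k => [|t IH] k kt o.
  by rewrite sub0n big_geq// subr0.
case: k => [|k] in kt *; first by rewrite subn0 big_geq// subr0.
rewrite subSS big_nat_recr ?leq_subr//= opprD addrA -IH//.
by rewrite wE.2.
Qed.

(** Both vectors start from [w (t - tau)], so they differ by the entries of window updates hidden by
    [Sigma]. Masking entries does not increase the norm. *)
Let delay_le t o : nsq (what t o - w t o) <=
  2 ^+ tau * \sum_(t - tau <= j < t) nsq (upd j o).
Proof.
set m := (t - tau)%N.
have mt : (m <= t)%N by exact: leq_subr.
have km : (t - m <= tau)%N by rewrite /m leq_subCl.
have -> : what t o - w t o =
    \sum_(m <= j < t) (upd j o - upd j o *m diag01 (Sigma t j o)).
  rewrite sumrB whatE (w_window (leq_subr m t)) subKn//.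
  by rewrite opprB [LHS]addrC subrKA.
have := nsq_sum_le (t - m) m (fun j => upd j o - upd j o *m diag01 (Sigma t j
  o)).
rewrite subnKC// => /le_trans; apply.
apply: ler_pM; rewrite ?exprn_ge0//.
- by apply: sumr_ge0 => j _; exact: nsq_ge0.
- by rewrite ler_eXn2l// ltr1n.
apply: ler_sum_nat => j _; apply: ler_sum => i _.
rewrite mxE [X in _ + X]mxE mul_diag01E.
by case: (i \in _); rewrite ?mulr1 ?subrr ?mulr0 ?subr0// expr0n sqr_ge0.
Qed.

Let upd_le t o : nsq (upd t o) <=
  eta t ^+ 2 * (2 * D%:R ^+ 2 * (L ^+ 2 * nsq (what t o - wstar) + gs t o)).
Proof.
rewrite updE nsqZ; apply: ler_wpM2l; first exact: sqr_ge0.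
exact: nsq_filtered_grad_crude.
Qed.

Let L1_upd t : L1 P (fun o => nsq (what t o - wstar)) ->
  L1 P (fun o => nsq (upd t o)).
Proof.
move=> ih; apply: (L1_ge0_dom _ (fun o => _)); last first.
- apply: (L1Z (eta t ^+ 2)); apply: (L1Z (2 * D%:R ^+ 2)).
  by apply: L1D; [exact: (L1Z (L ^+ 2) ih)|exact: (L1_gs t).1].
- by move=> o; rewrite nsq_ge0; exact: upd_le.
- apply: measurable_nsq.
  have -> : upd t = fun o => eta t *: G t (what t o) o by exact/funext/updE.
  apply: measurable_vec_scale; first exact: measurable_cst.
  exact: (measurable_filtered_grad xi u fS smf unbf t (measurable_iterate t).2).
Qed.

Let mB (V : Omega -> 'rV[R]_n) : measurable_vec V -> measurable_fun setT (fun o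
  => nsq (V o - wstar)).
Proof.
by move=> mV; apply/measurable_nsq/measurable_vecB => //; exact:
  measurable_vec_cst.
Qed.

Let L1_delay t : (forall j, (j < t)%N -> L1 P (fun o => nsq (what j o - wstar)))
  ->
  L1 P (fun o => nsq (what t o - w t o)).
Proof.
move=> ih; have [mw mwhat] := measurable_iterate t.
apply: (L1_ge0_dom (h := fun o => 2 ^+ tau * \sum_(t - tau <= j < t) nsq (upd j
  o))).
- exact/measurable_nsq/measurable_vecB.
- by move=> o; rewrite nsq_ge0; exact: delay_le.
- apply: L1Z; apply: L1_sum => j; rewrite mem_index_iota => /andP[_ jt].
  exact/L1_upd/ih.
Qed.

Let L1_what_of_w t : L1 P (fun o => nsq (w t o - wstar)) ->
    (forall j, (j < t)%N -> L1 P (fun o => nsq (what j o - wstar))) ->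
  L1 P (fun o => nsq (what t o - wstar)).
Proof.
move=> iw ih; have [mw mwhat] := measurable_iterate t.
apply: (L1_ge0_dom
  (h := fun o => 2 * nsq (w t o - wstar) + 2 * nsq (what t o - w t o))).
- exact: mB.
- move=> o; rewrite nsq_ge0/= [leRHS]addrC.
  by rewrite -[X in nsq X <= _](subrKA (w t o)); exact: nsqD_le.
- by apply: L1D; apply: L1Z => //; exact: L1_delay.
Qed.

Lemma L1_moments t : L1 P (fun o => nsq (w t o - wstar)) /\
  L1 P (fun o => nsq (what t o - wstar)).
Proof.
elim/ltn_ind: t => t IH.
suff iw : L1 P (fun o => nsq (w t o - wstar)).
  by split=> //; apply: L1_what_of_w => // j jt; exact: (IH j jt).2.
case: t => [|t] in IH *.
  by under eq_fun do rewrite wE.1; exact: L1_cst.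
have [iw ih] := IH t (ltnSn t).
apply: (L1_ge0_dom (h := fun o => 2 * nsq (w t o - wstar) + 2 * nsq (upd t o))).
- exact/mB/(measurable_iterate t.+1).1.
- move=> o; rewrite nsq_ge0/= wE.2 -(nsqN (upd t o)).
  by rewrite addrAC; exact: nsqD_le.
- by apply: L1D; apply: L1Z => //; exact: L1_upd.
Qed.

Let s := \int[Q]_x nsq (grad (f^~ x) wstar).

(** One of the two factors [size (S x)] in the square is compensated by the uniform choice of the
    filter, so that a single [D] remains. The point [wstar] is deterministic, which makes this
    averaging available. *)
Lemma L1_filtered_grad_wstar t : L1 P (fun o => nsq (G t wstar o)) /\
  \int[P]_o nsq (G t wstar o) <= D%:R * s.
Proof.
pose b i x : R := (size (S x))%:R * grad (f^~ x) wstar 0 i ^+ 2.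
have b0 i x : 0 <= b i x by rewrite mulr_ge0 ?sqr_ge0.
have mb i : measurable_fun setT (b i).
  apply: measurable_funM.
    exact: (measurable_filters fS (fun s => (size s)%:R : R)).
  by apply: measurable_funX; exact: (measurable_grad unbf wstar i).
have ib i : L1 Q (b i).
  apply: (L1_ge0_dom (mb i) _ (L1Z D%:R igrad)) => x; rewrite b0/=.
  apply: ler_pM; rewrite ?sqr_ge0 ?coord_sq_le//.
  by rewrite ler_nat (size_filters_le fS).
have GE : (fun o => nsq (G t wstar o)) = fun o =>
    \sum_(i < n) ((size (S (xi t o)))%:R * b i (xi t o) *
                   (i \in chosen_filter S xi u t o)%:R).
  apply/funext => o; rewrite /G /filtered_grad nsqZ nsq_diag01 mulr_sumr.
  by apply: eq_bigr => i _; rewrite /b expr2 !mulrA.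
have ic i := L1_chosen_coord fS freshP t i (ib i).
rewrite GE; split; first by apply: L1_sum => i _; exact: (ic i).1.
rewrite Rintegral_sum; last by move=> i _; exact: (ic i).1.
rewrite (eq_bigr _ (fun i _ => (ic i).2)) -Rintegral_sum; last first.
  by move=> i _; exact: (L1_mem_Dxi fS i (ib i)).
rewrite /s -RintegralZl//; apply: le_Rintegral => //.
- by apply: L1_sum => i _; exact: (L1_mem_Dxi fS i (ib i)).
- exact: L1Z.
move=> x _; rewrite mulr_sumr; apply: ler_sum => i _.
rewrite /b; apply: (@le_trans _ _ ((size (S x))%:R * grad (f^~ x) wstar 0 i ^+
  2)).
  by case: (i \in _); rewrite ?mulr1 ?mulr0 ?b0.
by rewrite ler_wpM2r ?sqr_ge0// ler_nat (size_filters_le fS).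
Qed.

Let xw t := \int[P]_o nsq (w t o - wstar).
Let xh t := \int[P]_o nsq (what t o - wstar).
Let dl t := \int[P]_o nsq (what t o - w t o).

Let L1_dl t : L1 P (fun o => nsq (what t o - w t o)).
Proof. by apply: L1_delay => j _; exact: (L1_moments j).2. Qed.

Lemma moment_what_le t : xh t <= 2 * xw t + 2 * dl t.
Proof.
have [iw ih] := L1_moments t; have id := L1_dl t.
rewrite /xh /xw /dl -!RintegralZl// -RintegralD//; try exact: L1Z.
apply: le_Rintegral => //; first by apply: L1D; exact: L1Z.
move=> o _; rewrite [leRHS]addrC.
by rewrite -[X in nsq X <= _](subrKA (w t o)); exact: nsqD_le.
Qed.

Lemma moment_delay_le t : dl t <= \sum_(t - tau <= j < t) eta j ^+ 2 *
  (2 ^+ tau * (2 * D%:R ^+ 2) * s + 2 ^+ tau * (2 * D%:R ^+ 2) * L ^+ 2 * xh j).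
Proof.
have iu j : L1 P (fun o => nsq (upd j o)) by apply: L1_upd; exact: (L1_moments
  j).2.
apply: (@le_trans _ _ (2 ^+ tau * \sum_(t - tau <= j < t) \int[P]_o nsq (upd j
  o))).
  rewrite -Rintegral_sum; last by move=> j _; exact: iu.
  rewrite -RintegralZl//; last by apply: L1_sum => j _; exact: iu.
  apply: le_Rintegral => //; first exact: L1_dl.
  by apply: L1Z; apply: L1_sum => j _; exact: iu.
rewrite mulr_sumr; apply: ler_sum => j _.
have [igs Egs] := L1_gs j; have [_ ih] := L1_moments j.
have ig : L1 P (fun o => L ^+ 2 * nsq (what j o - wstar) + gs j o).
  by apply: L1D => //; exact: L1Z.
have : \int[P]_o nsq (upd j o) <=
    eta j ^+ 2 * (2 * D%:R ^+ 2 * (L ^+ 2 * xh j + s)).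
  apply: (le_trans (le_Rintegral measurableT (iu j)
    (L1Z (eta j ^+ 2) (L1Z (2 * D%:R ^+ 2) ig)) (fun o _ => upd_le j o))).
  rewrite RintegralZl//; last exact: L1Z.
  rewrite RintegralZl// RintegralD//; last exact: L1Z.
  by rewrite RintegralZl// Egs.
move=> /(ler_wpM2l (exprn_ge0 tau (ler0n R 2))) /le_trans; apply.
by rewrite le_eqVlt; apply/orP; left; apply/eqP; ring.
Qed.

(** The inner product at [what t] is replaced by the one at [w t]. The Young weight [4 / mu] is
    chosen so that only [mu / 4] of the contraction is lost. *)
Let step_le t o : 0 <= eta t ->
  nsq (w t.+1 o - wstar) <= (1 + eta t * (mu / 4)) * nsq (w t o - wstar) -
    2 * eta t * vdot (G t (w t o) o) (w t o - wstar) +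
    (eta t * (4 / mu * (D%:R ^+ 2 * L ^+ 2)) * nsq (what t o - w t o) +
    eta t ^+ 2 * (2 * nsq (G t wstar o) +
                  2 * (D%:R ^+ 2 * L ^+ 2) * nsq (what t o - wstar))).
Proof.
move=> eta0; set x := w t o - wstar.
set g := G t (what t o) o; set gw := G t (w t o) o; set gst := G t wstar o.
have -> : w t.+1 o - wstar = - (eta t *: g) + x.
  by rewrite /x wE.2 -/upd updE addrAC addrC.
rewrite (nsqD (- (eta t *: g)) x) nsqN nsqZ vdotNl vdotZl.
have mu4 : 0 < 4 / mu by exact: divr_gt0.
have y1 := vdot_young (gw - g) x mu4.
rewrite vdotDl vdotNl invf_div in y1.
have l1 : nsq (gw - g) <= D%:R ^+ 2 * L ^+ 2 * nsq (what t o - w t o).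
  by rewrite (nsqBC (what t o)); exact: nsq_filtered_grad_le.
have l2 : nsq (g - gst) <= D%:R ^+ 2 * L ^+ 2 * nsq (what t o - wstar).
  exact: nsq_filtered_grad_le.
have l3 := nsqD_le (g - gst) gst; rewrite subrK in l3.
have m1 := ler_wpM2l (ltW mu4) l1.
apply: step_arith => //.
  by rewrite mulrBr -mulrBr; apply: (le_trans y1); exact: lerD.
apply: (le_trans l3); rewrite lerD2r; apply: ler_wpM2l => //.
Qed.

Lemma moment_step t : 0 <= eta t ->
  xw t.+1 <= (1 - 3 / 4 * mu * eta t) * xw t +
    eta t * (4 / mu * (D%:R ^+ 2 * L ^+ 2)) * dl t +
    eta t ^+ 2 * (2 * (D%:R * s) + 2 * (D%:R ^+ 2 * L ^+ 2) * xh t).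
Proof.
move=> eta0; have [iw ih] := L1_moments t; have id := L1_dl t.
have [mw _] := measurable_iterate t.
have [ig gle] := L1_filtered_grad_wstar t.
have iv := L1_filtered_grad_comp fS freshP smf unbf igrad t mw iw.
have cross := cross_term fS freshP smf unbf (ltW mu_gt0) scF minF igrad mw iw
  (@history_iterate t).
pose c := D%:R ^+ 2 * L ^+ 2.
have i1 := L1Z (1 + eta t * (mu / 4)) iw.
have i2 := L1Z (2 * eta t) iv.
have i3 := L1Z (eta t * (4 / mu * c)) id.
have i4 := L1D (L1Z 2 ig) (L1Z (2 * c) ih).
have i5 := L1Z (eta t ^+ 2) i4.
have := le_Rintegral measurableT (L1_moments t.+1).1 (L1D (L1B i1 i2) (L1D i3
  i5))
  (fun o _ => step_le o eta0).
rewrite -/(xw t.+1) (RintegralD measurableT (L1B i1 i2) (L1D i3 i5)).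
rewrite (RintegralB measurableT i1 i2) (RintegralD measurableT i3 i5).
rewrite (RintegralZl _ measurableT iw) (RintegralZl _ measurableT iv).
rewrite (RintegralZl _ measurableT id) (RintegralZl _ measurableT i4).
rewrite (RintegralD measurableT (L1Z 2 ig) (L1Z (2 * c) ih)).
rewrite (RintegralZl _ measurableT ig) (RintegralZl _ measurableT ih).
rewrite -/(xw t) -/(dl t) -/(xh t) -/c.
have e1 := ler_wpM2l eta0 cross.
have e2 := ler_wpM2l (sqr_ge0 (eta t)) gle.
exact: moment_arith.
Qed.

End one_step.

(** * From the weighted bounds to the stated estimates *)

Section remainder.
Context {R : realType}.

Lemma bigO_remainder (v : nat -> R) (c E B K : R) : 0 < E ->
    (forall t, (0 < t)%N ->
      v t * (t%:R + E - 1) ^+ 2 <= B + t%:R * c + K * ln t%:R) ->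
  exists h : nat -> R, h =O_\oo (fun t => ln t%:R / (t%:R + E - 1) ^+ 2) /\
    forall t, v t <= c * (t%:R / (t%:R + E - 1) ^+ 2) + h t.
Proof.
move=> E0 vB; pose g t : R := (t%:R + E - 1) ^+ 2.
(* The remainder is the excess over the main term, cut off at zero, so the inequality holds for all
   [t], including those where nothing is known about [v]. *)
exists (fun t => Num.max (v t - c * (t%:R / g t)) 0); split; last first.
  by move=> t; rewrite -lerBlDl le_max lexx.
apply/eqO_exP; exists (`|B| + `|K| + 1); first by rewrite ltr_wpDl// addr_ge0.
(* From here on [ln t >= 1], and the constant [B] is absorbed by [ln t]. *)
exists (Num.bound (expR 1 : R)).+1 => // t /= et.
have t0 : (0 < t)%N by exact: leq_trans et.
have t1 : 1 <= t%:R :> R by rewrite ler1n.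
have lnt : 1 <= ln t%:R :> R.
  rewrite -[leLHS](@expRK R) ler_ln ?posrE ?expR_gt0 ?ltr0n//.
  apply: (@le_trans _ _ (Num.bound (expR 1 : R))%:R); last by rewrite ler_nat
    ltnW.
  by apply/ltW/archi_boundP/ltW/expR_gt0.
have g0 : 0 < g t by rewrite exprn_gt0//; lra.
rewrite ger0_norm; last by rewrite le_max lexx orbT.
have lg0 : 0 <= ln t%:R / g t by rewrite divr_ge0 ?(ltW g0)//; lra.
rewrite -/(g t) [X in _ <= _ * X]ger0_norm//.
rewrite ge_max; apply/andP; split; last first.
  by rewrite mulr_ge0 ?addr_ge0.
have l0 : 0 <= ln t%:R :> R by exact: le_trans lnt.
rewrite lerBlDr mulrA [c * _]mulrA -mulrDl ler_pdivlMr//.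
apply: (le_trans (vB t t0)); rewrite addrAC [c * _]mulrC lerD2r.
rewrite !mulrDl mul1r -[leLHS]addr0; apply: lerD => //; apply: lerD.
  by apply: (le_trans (ler_norm B)); rewrite ler_peMr.
by rewrite ler_wpM2r// ler_norm.
Qed.

End remainder.

Lemma moment_bounds (R : realType) (n : nat)
    (d : measure_display) (X : measurableType d) (Q : probability X R)
    (f : 'rV[R]_n -> X -> R)
    (d' : measure_display) (Omega : measurableType d')
    (P : probability Omega R)
    (D tau : nat) (mu L alpha E : R) (a : nat -> R)
    (S : X -> seq {set 'I_n})
    (xi : nat -> {RV P >-> X}) (u : nat -> {RV P >-> nat})
    (Sigma : nat -> nat -> Omega -> {set 'I_n})
    (w0 wstar : 'rV[R]_n) (w what : nat -> Omega -> 'rV[R]_n) :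
  let eta := fun t : nat => a t / (mu * (t%:R + E)) in
  let s := \int[Q]_x nsq (grad (f^~ x) wstar) in
  let c := 4 * alpha ^+ 2 * D%:R / mu ^+ 2 * (2 * s) in
  let bound := fun h t => c * (t%:R / (t%:R + E - 1) ^+ 2) + h t in
  unbiased_gradient Q f ->
  0 < mu -> strongly_convex mu (objective Q f) ->
  (forall x, smooth L (f^~ x)) ->
  (forall v, objective Q f wstar <= objective Q f v) ->
  filter_family f D S ->
  fresh_sampling Q S xi u Sigma ->
  (forall t, 4 <= a t <= alpha) -> 0 < E -> 2 * tau%:R <= E ->
  hogwild_recursion f S xi u eta w0 w what ->
  consistent_with_delay f S xi u Sigma tau eta w what ->
  L1 Q (fun x => nsq (grad (f^~ x) wstar)) ->
  exists hhat h : nat -> R,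
    [/\ hhat =O_\oo (fun t => ln t%:R / (t%:R + E - 1) ^+ 2),
        h =O_\oo (fun t => ln t%:R / (t%:R + E - 1) ^+ 2),
        forall t, \int[P]_o nsq (what t o - wstar) <= bound hhat t
      & forall t, \int[P]_o nsq (w t o - wstar) <= bound h t].
Proof.
move=> eta s c bound unbf mu0 scF smf minF fS freshP aE E0 tauE wE whatE igrad.
pose x t := \int[P]_o nsq (w t o - wstar).
pose xh t := \int[P]_o nsq (what t o - wstar).
pose dl t := \int[P]_o nsq (what t o - w t o).
have intge0 d1 (T : measurableType d1) (m : probability T R) (g : T -> 'rV[R]_n)
  :
  0 <= \int[m]_o nsq (g o) by apply: Rintegral_ge0 => o _; exact: nsq_ge0.
have s0 : 0 <= s by exact: intge0.
have y0 t : 0 < t%:R + E by rewrite ltr_wpDl.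
have eta0 t : 0 <= eta t.
  by rewrite divr_ge0 ?mulr_ge0 ?(ltW mu0) ?(ltW (y0 t))//; have := aE t; lra.
have step t := moment_step fS freshP smf unbf mu0 scF minF igrad wE whatE (eta0
  t).
have dle := moment_delay_le fS freshP smf unbf igrad wE whatE.
have hle := moment_what_le fS freshP smf unbf igrad wE whatE.
have DL0 : 0 <= D%:R ^+ 2 * L ^+ 2 by rewrite mulr_ge0 ?sqr_ge0.
have A0 : 0 <= 2 * (D%:R * s) by rewrite mulr_ge0// mulr_ge0.
have c10 : 0 <= 4 / mu * (D%:R ^+ 2 * L ^+ 2).
  by rewrite mulr_ge0// divr_ge0// ltW.
have c20 : 0 <= 2 * (D%:R ^+ 2 * L ^+ 2) by rewrite mulr_ge0.
have tD0 : 0 <= 2 ^+ tau * (2 * D%:R ^+ 2) :> R.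
  by rewrite mulr_ge0 ?exprn_ge0// mulr_ge0 ?sqr_ge0.
have k10 : 0 <= 2 ^+ tau * (2 * D%:R ^+ 2) * s by exact: mulr_ge0.
have k20 : 0 <= 2 ^+ tau * (2 * D%:R ^+ 2) * L ^+ 2.
  by rewrite mulr_ge0// sqr_ge0.
have x0 t : 0 <= x t by exact: intge0.
have xh0 t : 0 <= xh t by exact: intge0.
have [B [K xB]] := weighted_bound mu0 E0 aE tauE A0 c10 c20 k10 k20 x0 xh0
  step dle hle.
have [K' K'0 dK] := delta_decay mu0 E0 aE tauE A0 c10 c20 k10 k20 x0 xh0
  step dle hle.
set q := 2 * (D%:R * s) * (alpha / mu) ^+ 2 in xB.
have q0 : 0 <= q by rewrite mulr_ge0 ?sqr_ge0.
(* The recursion yields the leading constant [q] for [w] and [2 * q] for [what]; both lie below the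
   claimed [4 * q]. *)
have cE : c = 4 * q by rewrite /c /q; field; rewrite gt_eqF.
have [h [hO hB]] := bigO_remainder E0 xB.
(* From [xhat <= 2 * x + 2 * delta]: the main term doubles, while the weighted delay is bounded by
   [K'] and joins the constant. *)
have xhB t : (0 < t)%N -> xh t * (t%:R + E - 1) ^+ 2 <=
    2 * (B + K') + t%:R * (2 * q) + 2 * K * ln t%:R.
  move=> t0; have t1 : 1 <= t%:R :> R by rewrite ler1n.
  have g0 : 0 <= (t%:R + E - 1) ^+ 2 by exact: sqr_ge0.
  have dg : dl t * (t%:R + E - 1) ^+ 2 <= K'.
    apply: (@le_trans _ _ (K' / (t%:R + E) ^+ 2 * (t%:R + E - 1) ^+ 2)).
      by apply: ler_wpM2r => //; exact: dK.
    rewrite mulrAC ler_pdivrMr ?exprn_gt0//; apply: ler_wpM2l => //.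
    by apply: lerXn2r; rewrite ?nnegrE; lra.
  apply: (le_trans (ler_wpM2r g0 (hle t))); rewrite mulrDl -!mulrA.
  by have := xB t t0; move: dg; rewrite -/(dl t) -/(x t); lra.
have [hhat [hhO hhB]] := bigO_remainder E0 xhB.
have frac0 t : 0 <= t%:R / (t%:R + E - 1) ^+ 2 by rewrite divr_ge0 ?sqr_ge0.
exists hhat, h; split=> // t; rewrite /bound cE.
  by apply: (le_trans (hhB t)); rewrite lerD2r ler_wpM2r//; lra.
by apply: (le_trans (hB t)); rewrite lerD2r ler_wpM2r//; lra.
Qed.

Theorem theorem7 (R : realType) (n : nat)
    (d : measure_display) (X : measurableType d) (Q : probability X R)
    (f : 'rV[R]_n -> X -> R)
    (d' : measure_display) (Omega : measurableType d')
    (P : probability Omega R)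
    (D tau : nat) (mu L alpha E : R) (a : nat -> R)
    (S : X -> seq {set 'I_n})
    (xi : nat -> {RV P >-> X}) (u : nat -> {RV P >-> nat})
    (Sigma : nat -> nat -> Omega -> {set 'I_n})
    (w0 wstar : 'rV[R]_n) (w what : nat -> Omega -> 'rV[R]_n) :
  let F := objective Q f in
  let kappa := L / mu in
  let eta := fun t : nat => a t / (mu * (t%:R + E)) in
  let DeltaD := (D%:R%:E * 'E_Q[fun x => (ceil_divn #|Dxi f x| D)%:R%R])%E in
  let t' := fun t : nat => ((t%:R / D%:R)%R%:E * DeltaD)%E in
  let N := (2%:E * 'E_Q[fun x => (enorm (grad (f^~ x) wstar) ^+ 2)%R])%E in
  (forall w, Q.-integrable setT (fun x => (f w x)%:E)) ->
  (forall x w, differentiable (f^~ x) w) ->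
  (forall w, differentiable F w) ->
  unbiased_gradient Q f ->
  0 < mu -> strongly_convex mu F ->
  0 < L -> (forall x, smooth L (f^~ x)) ->
  (forall w, F wstar <= F w) ->
  (0 < D)%N -> filter_family f D S ->
  fresh_sampling Q S xi u Sigma ->
  (forall t, 4 <= a t <= alpha) ->
  2 * tau%:R <= E -> 4 * L * kappa * alpha * D%:R / mu <= E ->
  hogwild_recursion f S xi u eta w0 w what ->
  consistent_with_delay f S xi u Sigma tau eta w what ->
  [/\ forall t, ('E_P[fun o => (entry_updates S xi u t o)%:R%R] <= t' t)%E,
      (\forall x \ae Q, forall A, A \in S x ->
         #|A| = ceil_divn #|Dxi f x| D) ->
      forall t, 'E_P[fun o => (entry_updates S xi u t o)%:R%R]%E = t' t
    & exists hhat h : nat -> R,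
      [/\ hhat =O_\oo (fun t => ln t%:R / (t%:R + E - 1) ^+ 2),
          h =O_\oo (fun t => ln t%:R / (t%:R + E - 1) ^+ 2),
          forall t, ('E_P[fun o => (enorm (what t o - wstar) ^+ 2)%R] <=
            (4 * alpha ^+ 2 * D%:R / mu ^+ 2)%R%:E * N
              * (t%:R / (t%:R + E - 1) ^+ 2)%R%:E + (hhat t)%:E)%E
        & forall t, ('E_P[fun o => (enorm (w t o - wstar) ^+ 2)%R] <=
            (4 * alpha ^+ 2 * D%:R / mu ^+ 2)%R%:E * N
              * (t%:R / (t%:R + E - 1) ^+ 2)%R%:E + (h t)%:E)%E]].
Proof.
move=> F kappa eta DeltaD t' N _ _ _ unbf mu0 scF L0 smf minF D0 fS freshP aE.
move=> tauE LE wE whatE.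
have D0R : 0 < D%:R :> R by rewrite ltr0n.
have alpha0 : 0 < alpha by have := aE 0%N; lra.
have E0 : 0 < E.
  by apply: lt_le_trans LE; rewrite /kappa !(mulr_gt0, divr_gt0, invr_gt0).
have t'E t : t' t = (t%:R%:E * \int[Q]_x ((ceil_divn #|Dxi f x| D)%:R)%:E)%E.
  by rewrite /t' /DeltaD unlock muleA -EFinM divfK// gt_eqF.
have mceil := measurable_ceil_card_Dxi fS.
have minv : measurable_fun setT
    (fun x => (size (S x))%:R^-1 * #|Dxi f x|%:R : R).
  apply: measurable_funM; last exact: measurable_card_Dxi fS.
  exact: (measurable_filters fS (fun s => (size s)%:R^-1 : R)).
have inv0 x : 0 <= (size (S x))%:R^-1 * #|Dxi f x|%:R :> R by rewrite mulr_ge0.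
split=> [t|cardS t|].
- rewrite (expectation_entry_updates fS freshP) t'E lee_wpmul2l ?lee_fin//.
  apply: ge0_le_integral => //.
  + exact/measurable_EFinP.
  + exact/measurable_EFinP.
  + by move=> x _; rewrite lee_fin (inv_size_card_Dxi_le fS).
- rewrite (expectation_entry_updates fS freshP) t'E; congr (_ * _)%E.
  apply: ae_eq_integral => //.
  + exact/measurable_EFinP.
  + exact/measurable_EFinP.
  + apply: filterS cardS => x cardSx _.
    by rewrite (inv_size_card_Dxi_eq fS D0 cardSx).
have EP (V : Omega -> 'rV[R]_n) :
    'E_P[fun o => (enorm (V o) ^+ 2)%R]%E = (\int[P]_o (nsq (V o))%:E)%E.
  by rewrite unlock; under eq_integral do rewrite enorm_sq.
have mgrad : measurable_fun setT (fun x => nsq (grad (f^~ x) wstar)).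
  by apply: measurable_nsq => i; exact: (measurable_grad unbf).
have c0 : 0 < 4 * alpha ^+ 2 * D%:R / mu ^+ 2.
  by rewrite divr_gt0 ?exprn_gt0// mulr_gt0// mulr_gt0 ?exprn_gt0.
have [Noo|Nfin] := eqVneq (\int[Q]_x (nsq (grad (f^~ x) wstar))%:E)%E +oo%E.
  (* For [t > 0] the right side is infinite. At [t = 0] the main term is [+oo * 0 = 0], so [h 0] has
     to carry the initial distance; a single value is irrelevant for the order of growth. *)
  pose h (t : nat) : R := if t is 0 then nsq (w0 - wstar) else 0.
  have hO : h =O_\oo (fun t => ln t%:R / (t%:R + E - 1) ^+ 2).
    apply/eqO_exP; exists 1 => //; exists 1%N => // -[//|t] _ /=.
    by rewrite normr0 mul1r.
  have bound v : (forall o, v 0%N o = w0) -> forall t,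
      ('E_P[fun o => (enorm (v t o - wstar) ^+ 2)%R] <=
        (4 * alpha ^+ 2 * D%:R / mu ^+ 2)%R%:E * N
          * (t%:R / (t%:R + E - 1) ^+ 2)%R%:E + (h t)%:E)%E.
    move=> v0 [|t].
      rewrite mul0r mule0 add0e EP.
      under eq_integral do rewrite v0.
      by rewrite integral_cst//= probability_setT mule1.
    rewrite [leRHS](_ : _ = +oo%E) ?leey//.
    have -> : N = +oo%E.
      rewrite /N unlock; under eq_integral do rewrite enorm_sq.
      by rewrite Noo gt0_muley ?lte_fin.
    rewrite gt0_muley ?lte_fin// gt0_mulye ?lte_fin//.
    by rewrite divr_gt0 ?ltr0n// exprn_gt0// -natr1 addrAC addrK ltr_wpDl.
  exists h, h; split=> //; apply: bound.
  - by move=> o; rewrite whatE sub0n big_geq// subr0; exact: wE.1.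
  - exact: wE.1.
have igrad : L1 Q (fun x => nsq (grad (f^~ x) wstar)).
  apply: L1_of_finite => //; first by move=> x; exact: nsq_ge0.
  by rewrite lt_neqAle Nfin leey.
have [hhat [h [hhatO hO hhatB hB]]] := moment_bounds unbf mu0 scF smf minF fS
  freshP aE E0 tauE wE whatE igrad.
have NE : N = (2 * \int[Q]_x nsq (grad (f^~ x) wstar))%:E.
  rewrite /N unlock; under eq_integral do rewrite enorm_sq.
  by rewrite (EFin_Rintegral igrad).
have iM t := L1_moments fS freshP smf unbf igrad wE whatE t.
exists hhat, h; split=> // t; rewrite EP NE -!EFinM -EFinD.
  by rewrite (EFin_Rintegral (iM t).2) lee_fin; exact: hhatB.
by rewrite (EFin_Rintegral (iM t).1) lee_fin; exact: hB.
Qed.
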